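(* Let $\Gamma=(\gamma_1,\dots,\gamma_r)$ be a tuple of symmetric free polynomials in $x=(x_1,\dots,x_g)$ with $g\le r$ and $\gamma_j=x_j$ for $1\le j\le g$. Suppose $\mathfrak K\subseteq B(\mathcal H)^g_{sa}$ is a free set. If $\mathfrak K$ is bounded and SOT-closed, then the operator convex hull of $\Gamma(\mathfrak K)\subseteq B(\mathcal H)^r_{sa}$ and the operator $\Gamma$-convex hull of $\mathfrak K$ are SOT-closed.
   Context: $\mathcal H$ is a fixed infinite-dimensional separable complex Hilbert space and $B(\mathcal H)^g_{sa}$ is the set of $g$-tuples of bounded self-adjoint operators on $\mathcal H$, with norm $\|X\|=\max_j\|X_j\|$; the strong operator topology (SOT) on tuples is taken coordinatewise. Free polynomials are elements of the free algebra $\mathbb C\langle x\rangle$ in noncommuting variables, with the conjugate-linear involution fixing each $x_j$ and reversing words; symmetric means $p^*=p$. $\Gamma(X)=(\gamma_1(X),\dots,\gamma_r(X))$ for $X\in B(\mathcal H)^g_{sa}$. A set $\mathfrak K\subseteq B(\mathcal H)^g_{sa}$ is free if it is closed under simultaneous unitary similarity and under (finite) direct sums, where $\mathcal H\oplus\cdots\oplus\mathcal H$ is identified with $\mathcal H$ by a unitary. A pair $(X,V)$ with $X\in B(\mathcal H)^g_{sa}$ and $V:\mathcal H\to\mathcal H$ an isometry is an (operator) $\Gamma$-pair if $V^*\Gamma(X)V=\Gamma(V^*XV)$ (coordinatewise). A set is operator $\Gamma$-convex if it is free and contains $V^*XV$ whenever it contains $X$ and $(X,V)$ is a $\Gamma$-pair;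 operator convex means operator $\Gamma$-convex for $\Gamma(x)=x$, i.e. free and closed under $X\mapsto V^*XV$ for all isometries $V$ on $\mathcal H$. The operator convex hull (resp. operator $\Gamma$-convex hull) of a set is the intersection of all operator convex (resp. operator $\Gamma$-convex) sets containing it. *)

(* Defs.v *)
From HB Require Import structures.
From mathcomp Require Import all_boot all_order all_algebra ring lra.
From mathcomp Require Import complex monalg.
From mathcomp Require Import(coercions) finmap.
From mathcomp Require Import all_classical interval_inference reals topology normedtype sequences.

Set Implicit Arguments.
Unset Strict Implicit.
Unset Printing Implicit Defensive.

Import Order.TTheory GRing.Theory Num.Theory numFieldNormedType.Exports.

Local Open Scope classical_set_scope.
Local Open Scope complex_scope.
Local Open Scope ring_scope.

(* [hdot] is linear in its first argument and conjugate-linear in its second. *)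
HB.mixin Record isHilbert (R : realType) H of CompleteNormedModule R[i] H := {
  hdot : {dot H for Num.Def.conjC};
  hdotE : forall x : H, `|x| ^+ 2 = hdot x x }.

#[short(type="hilbertType")]
HB.structure Definition Hilbert (R : realType) :=
  {H of isHilbert R H & CompleteNormedModule R[i] H}.

(* The Riesz representation theorem, needed for the existence of adjoints. *)
Section Riesz.
Variables (R : realType) (H : hilbertType R).
Implicit Types (x y z w : H) (c : R[i]).
(* The norm of H takes its values in R[i]; [hnorm] is the same norm, in R. *)
Definition hnorm x : R := complex.Re `|x|.

Lemma hnormE x : `|x| = (hnorm x)%:C.
Proof. by rewrite /hnorm RRe_real// normr_real. Qed.

Lemma hnorm_ge0 x : 0 <= hnorm x.
Proof. by rewrite -ler0c -hnormE. Qed.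

Lemma hdotC x y : hdot x y = (hdot y x)^*%C.
Proof. by rewrite hermC /= expr0 mul1r. Qed.

Lemma hdotDl x y z : hdot (x + y) z = hdot x z + hdot y z.
Proof. by rewrite linearDl. Qed.

Lemma hdotDr z x y : hdot z (x + y) = hdot z x + hdot z y.
Proof. by rewrite linearDr. Qed.

Lemma hdotZl c x y : hdot (c *: x) y = c * hdot x y.
Proof. by rewrite linearZl_LR. Qed.

Lemma hdotZr c x y : hdot x (c *: y) = c^*%C * hdot x y.
Proof. by rewrite linearZr_LR. Qed.

Lemma hdotNl x y : hdot (- x) y = - hdot x y.
Proof. by rewrite linearNl. Qed.

Lemma hdotNr x y : hdot x (- y) = - hdot x y.
Proof. by rewrite linearNr. Qed.

Lemma hdot0l x : hdot 0 x = 0.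
Proof. by rewrite linear0l. Qed.

Lemma hnorm2E x : hdot x x = (hnorm x ^+ 2)%:C.
Proof. by rewrite -hdotE hnormE rmorphXn. Qed.

Lemma hdot_eqr x y : (forall w, hdot w x = hdot w y) -> x = y.
Proof.
move=> e; apply/eqP; rewrite -subr_eq0 -(dnorm_eq0 hdot) hdotDr hdotNr.
by rewrite e subrr.
Qed.

Lemma hnormZ c x : hnorm (c *: x) = complex.Re `|c| * hnorm x.
Proof. by rewrite /hnorm normrZ -[`|c|]RRe_real ?normr_real// hnormE -rmorphM. Qed.

Lemma hdot_CS_ring (a b d e : R[i]) : b * (b * a) - b * (e * d) +
  (- (d * (b * e)) - - (d * (e * b))) = b * (a * b - d * e).
Proof. by ring. Qed.

Lemma hdot_CS x y : `|hdot x y| <= `|x| * `|y|.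
Proof.
have [->|y0] := eqVneq y 0; first by rewrite linear0r !normr0 mulr0.
have b0 : 0 < hdot y y by rewrite dnorm_gt0.
rewrite -(@ler_pXn2r _ 2) ?nnegrE ?mulr_ge0// exprMn !hdotE normCK.
have bC : (hdot y y)^*%C = hdot y y by rewrite -hdotC.
have : 0 <= hdot (hdot y y *: x - hdot x y *: y) (hdot y y *: x - hdot x y *: y).
  exact: dnorm_ge0.
rewrite hdotDl !hdotDr !hdotNl !hdotNr !hdotZl !hdotZr bC (hdotC y x).
by rewrite hdot_CS_ring pmulr_rge0// subr_ge0.
Qed.

Lemma hnormZr (r : R) x : 0 <= r -> hnorm (r%:C *: x) = r * hnorm x.
Proof. by move=> r0; rewrite hnormZ ger0_norm ?ler0c. Qed.

Lemma hdot_CSr x y : complex.Re `|hdot x y| <= hnorm x * hnorm y.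
Proof.
by have := hdot_CS x y; rewrite !hnormE -rmorphM -[`|_|]RRe_real ?normr_real// lecR.
Qed.

Lemma ReD (a b : R[i]) : complex.Re (a + b) = complex.Re a + complex.Re b.
Proof. by case: a b => [? ?] [? ?]. Qed.

Lemma ReN (a : R[i]) : complex.Re (- a) = - complex.Re a.
Proof. by case: a. Qed.

Lemma ReMr (r : R) (a : R[i]) : complex.Re (r%:C * a) = r * complex.Re a.
Proof. by case: a => a b /=; rewrite mul0r subr0. Qed.

Lemma ReC (r : R) : complex.Re r%:C = r. Proof. by []. Qed.

Lemma Reconj (a : R[i]) : complex.Re a^*%C = complex.Re a. Proof. by case: a. Qed.

Lemma Re_mulconj (a : R[i]) : a * a^*%C = (complex.Re `|a| ^+ 2)%:C.
Proof. by rewrite -normCK -[in LHS](@RRe_real _ `|a|) ?normr_real// rmorphXn. Qed.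

Lemma Re_le_norm (a : R[i]) : complex.Re a <= complex.Re `|a|.
Proof.
case: a => a b; rewrite normc_def /= (le_trans (ler_norm _))// -sqrtr_sqr.
by rewrite ler_sqrt ?lerDl ?sqr_ge0 ?addr_ge0 ?sqr_ge0.
Qed.

Variable f : {scalar H}.
Variable M : R.
Hypothesis fM : forall x, complex.Re `|f x| <= M * hnorm x.

Let fD x y : f (x + y) = f x + f y. Proof. by rewrite linearD. Qed.
Let fZ c x : f (c *: x) = c * f x. Proof. by rewrite linearZ. Qed.

(* The representing vector is the limit of a minimizing sequence of [phi]. *)
Let phi x : R := hnorm x ^+ 2 - 2 * complex.Re (f x).

Lemma hnormB2 x y : hnorm (x + y) ^+ 2 =
  hnorm x ^+ 2 + hnorm y ^+ 2 + 2 * complex.Re (hdot x y).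
Proof.
rewrite -[LHS]ReC -[X in complex.Re X]hnorm2E hdotDl !hdotDr !hnorm2E (hdotC y x) !ReD Reconj !ReC.
move: (complex.Re _) => c; lra.
Qed.

Let phi_lb x : - M ^+ 2 <= phi x.
Proof.
have h1 : 2 * complex.Re (f x) <= 2 * (M * hnorm x).
  by rewrite ler_pM2l// (le_trans (Re_le_norm _)).
rewrite /phi; have := sqr_ge0 (hnorm x - M); nra.
Qed.

Let E := range phi.
Let m := inf E.
Let Einf : has_inf E.
Proof.
split; first by exists (phi 0); exists 0.
by exists (- M ^+ 2) => _ [x _ <-].
Qed.
Let mphi x : m <= phi x.
Proof. by apply: ge_inf; [case: Einf | exists x]. Qed.

Let ex_xn (n : nat) : exists x, phi x < m + n.+1%:R^-1.
Proof.
have [|_ [x _ <-] hx] := @inf_adherent R E (n.+1%:R^-1) _ Einf.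
  by rewrite invr_gt0.
by exists x.
Qed.
Let xn n := sval (cid (ex_xn n)).
Let xnP n : phi (xn n) < m + n.+1%:R^-1.
Proof. exact: (svalP (cid (ex_xn n))). Qed.

Let xn_dist i j : hnorm (xn i - xn j) ^+ 2 <= 2 * (i.+1%:R^-1 + j.+1%:R^-1).
Proof.
have h2 := mphi ((2^-1)%:C *: (xn i + xn j)).
have hi := xnP i; have hj := xnP j.
move: h2 hi hj; rewrite /phi hnormZr ?invr_ge0// fZ fD ReMr ReD exprMn !hnormB2.
rewrite hdotNr ReN.
have -> : hnorm (- xn j) = hnorm (xn j) by rewrite /hnorm normrN.
move: (hnorm (xn i) ^+ 2) (hnorm (xn j) ^+ 2) (complex.Re _) (complex.Re _) (complex.Re _) (i.+1%:R^-1) (j.+1%:R^-1).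
move=> a b c d e u v.
lra.
Qed.

Let xn_var n w : complex.Re `|hdot w (xn n) - f w| ^+ 2 <= n.+1%:R^-1 * (hnorm w ^+ 2 + 1).
Proof.
set d := hdot w (xn n) - f w.
pose s := (hnorm w ^+ 2 + 1)^-1.
have s0 : 0 < s by rewrite invr_gt0 ltr_wpDl ?sqr_ge0.
pose t := - (s%:C * d^*%C).
have := lt_le_trans (xnP n) (lerD (mphi (xn n + t *: w)) (lexx _)).
rewrite /phi hnormB2 fD fZ hdotZr ReD.
rewrite hnormZ exprMn.
have -> : complex.Re `|t| = s * complex.Re `|d|.
  rewrite /t normrN normrM ger0_norm ?ler0c ?(ltW s0)// ReMr.
  by congr (_ * complex.Re _); exact: norm_conjC.
have : complex.Re (t^*%C * hdot (xn n) w) - complex.Re (t * f w) = - s * complex.Re `|d| ^+ 2.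
  have -> : t^*%C * hdot (xn n) w = (t * hdot w (xn n))^*%C by rewrite (hdotC (xn n)); exact/esym/rmorphM.
  rewrite Reconj -ReN -ReD -mulrN -mulrDr -/d /t mulNr -mulrA [_ * d]mulrC Re_mulconj.
  by rewrite ReN -rmorphM /= mulNr.
move: (complex.Re (t^*%C * _)) (complex.Re (t * _)) (complex.Re (f _)) => a b c.
move: (complex.Re `|d|) (hnorm (xn n) ^+ 2) (n.+1%:R^-1) => D q e h1 h2.
have h3 : s * (hnorm w ^+ 2 + 1) = 1 by rewrite mulVf// gt_eqF// ltr_wpDl ?sqr_ge0.
have h4 : (s * D) ^+ 2 * hnorm w ^+ 2 = s * D ^+ 2 - (s * D) ^+ 2.
  rewrite -[X in X * _ - _]mulr1 -[X in _ * X * _ - _]h3; ring.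
rewrite -[leLHS]mul1r -[X in X * _]h3.
rewrite mulrAC ler_pM2r ?ltr_wpDl ?sqr_ge0//.
have := sqr_ge0 (s * D); lra.
Qed.

Let xn_cauchy : cauchy (xn @ \oo).
Proof.
apply/cauchy_ballP => e e0.
have [r r0 er] : exists2 r : R, 0 < r & e = r%:C.
  exists (complex.Re e); last by rewrite RRe_real// gtr0_real.
  by rewrite -ltcR RRe_real// gtr0_real.
have r40 : 0 < r ^+ 2 / 4 by rewrite divr_gt0// exprn_gt0.
rewrite near_map2; near=> i j.
rewrite -ball_normE /ball_/= er hnormE ltcR -(@ltr_pXn2r _ 2) ?nnegrE ?hnorm_ge0 ?ltW//.
rewrite (le_lt_trans (xn_dist _ _))//.
have : i.+1%:R^-1 < r ^+ 2 / 4.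
  by near: i; exact: (near_infty_natSinv_lt (PosNum r40)).
have : j.+1%:R^-1 < r ^+ 2 / 4.
  by near: j; exact: (near_infty_natSinv_lt (PosNum r40)).
move: (i.+1%:R^-1) (j.+1%:R^-1) (r ^+ 2) => a b c; lra.
Unshelve. all: by end_near. Qed.

Lemma riesz_representation : exists z, forall x, f x = hdot x z.
Proof.
have /cvg_ex[z xz] : cvgn xn by apply/cauchy_cvgP.
exists z => w; apply/eqP; rewrite -subr_eq0 -normr_eq0; apply/eqP.
rewrite -[LHS]RRe_real ?normr_real//; congr (_%:C).
apply/le_anti; rewrite -ler0c RRe_real ?normr_real// normr_ge0 andbT.
apply/ler_addgt0Pr => e e0; rewrite add0r.
have w0 : 0 < hnorm w + 1 by rewrite ltr_wpDl ?hnorm_ge0.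
have W0 : 0 < hnorm w ^+ 2 + 1 by rewrite ltr_wpDl ?sqr_ge0.
have d0 : 0 < (e / 2) ^+ 2 / (hnorm w ^+ 2 + 1) by rewrite divr_gt0// exprn_gt0// divr_gt0.
have c0 : 0 < e / 2 / (hnorm w + 1) by rewrite !divr_gt0.
near \oo => n.
have h1 : complex.Re `|hdot w (xn n) - f w| <= e / 2.
  rewrite -(@ler_pXn2r _ 2) ?nnegrE ?(ltW (divr_gt0 _ _))//; last first.
    by rewrite -ler0c RRe_real ?normr_real.
  rewrite (le_trans (xn_var _ _))// -ler_pdivlMr// ltW//.
  by near: n; exact: (near_infty_natSinv_lt (PosNum d0)).
have h2 : hnorm (z - xn n) <= e / 2 / (hnorm w + 1).
  rewrite -lecR -hnormE; near: n.
  by move/cvgrPdist_le : xz; apply; rewrite ltcR.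
have -> : f w - hdot w z = - (hdot w (z - xn n) + (hdot w (xn n) - f w)).
  by rewrite hdotDr hdotNr; ring.
rewrite normrN -lecR RRe_real ?normr_real// (le_trans (ler_normD _ _))//.
rewrite -[leLHS]RRe_real ?rpredD ?normr_real// lecR ReD [leRHS]splitr lerD//.
rewrite (le_trans (hdot_CSr _ _))//.
rewrite (@le_trans _ _ ((hnorm w + 1) * (e / 2 / (hnorm w + 1))))//.
  by rewrite ler_pM ?hnorm_ge0// lerDl.
by rewrite mulrCA mulfV ?mulr1// gt_eqF.
Unshelve. all: by end_near. Qed.
End Riesz.

Section Operators.
Variables (R : realType) (H : hilbertType R).

Record bop := BOp {
  bop_fun :> H -> H;
  bop_linear : linear bop_fun;
  bop_continuous : continuous bop_fun }.

HB.instance Definition _ (T : bop) :=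
  GRing.isLinear.Build R[i] H H *:%R T (bop_linear T).

Lemma bopP (S T : bop) : S =1 T -> S = T.
Proof.
case: S T => [s ls cs] [t lt ct] /= /funext e; subst t.
by congr BOp; exact: Prop_irrelevance.
Qed.

Lemma linear_hnorm_continuous (T : {linear H -> H}) (M : R) :
  (forall x, hnorm (T x) <= M * hnorm x) -> continuous T.
Proof.
move=> TM; apply: bounded_linear_continuous; apply/linear_boundedP.
near=> r => x; rewrite !hnormE (le_trans (_ : _ <= (M * hnorm x)%:C))//.
  by rewrite lecR.
rewrite rmorphM ler_wpM2r ?lecR ?hnorm_ge0//.
by near: r; apply: nbhs_pinfty_ge; rewrite realE ler0c lecR; case: leP => // /ltW ->; rewrite orbT.
Unshelve. all: by end_near. Qed.

Lemma bop_bounded (T : bop) :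
  exists2 M : R, 0 <= M & forall x, hnorm (T x) <= M * hnorm x.
Proof.
have := @continuous_linear_bounded _ _ _ 0 T (@bop_continuous T 0).
move=> /linear_boundedP/pinfty_ex_gt0[r r0 rT].
have rE : r = (complex.Re r)%:C by rewrite RRe_real// gtr0_real.
exists (complex.Re r); first by rewrite -lecR -rE ltW.
by move=> x; have := rT x; rewrite !hnormE [in X in X -> _]rE -rmorphM lecR.
Qed.

Lemma adj_exists (T : bop) (y : H) : exists z, forall x, hdot (T x) y = hdot x z.
Proof.
have [M M0 TM] := bop_bounded T.
pose f x := hdot (T x) y.
have fl : scalar f by move=> c u v; rewrite /f linearP hdotDl hdotZl.
pose fL := GRing.isLinear.Build R[i] H R[i] *%R f fl.
pose F : {scalar H} := HB.pack f fL.
apply: (@riesz_representation R H F (M * hnorm y)) => x.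
by rewrite (le_trans (hdot_CSr _ _))// mulrAC ler_wpM2r ?hnorm_ge0.
Qed.

Definition adj_fun (T : bop) (y : H) : H := sval (cid (adj_exists T y)).

Lemma adj_funP (T : bop) x y : hdot (T x) y = hdot x (adj_fun T y).
Proof. exact: (svalP (cid (adj_exists T y))). Qed.

Lemma adj_linear (T : bop) : linear (adj_fun T).
Proof.
move=> c x y; apply: hdot_eqr => w.
by rewrite -adj_funP !hdotDr !hdotZr !adj_funP.
Qed.

Lemma adj_continuous (T : bop) : continuous (adj_fun T).
Proof.
have [M M0 TM] := bop_bounded T.
pose F : {linear H -> H} := HB.pack (adj_fun T)
  (GRing.isLinear.Build R[i] H H *:%R (adj_fun T) (adj_linear T)).
apply: (@linear_hnorm_continuous F M) => x.
have [->|a0] := eqVneq (hnorm (F x)) 0; first by rewrite mulr_ge0 ?hnorm_ge0.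
have {}a0 : 0 < hnorm (F x) by rewrite lt_def a0 hnorm_ge0.
rewrite -(ler_pM2l a0) -expr2 -[leLHS]ReC -hnorm2E -[X in hdot _ X]/(adj_fun T x).
rewrite -adj_funP (le_trans (Re_le_norm _))// (le_trans (hdot_CSr _ _))//.
by rewrite mulrA [_ * M]mulrC ler_wpM2r ?hnorm_ge0.
Qed.

Definition adj (T : bop) : bop := BOp (@adj_linear T) (@adj_continuous T).

Lemma adjP (T : bop) x y : hdot (T x) y = hdot x (adj T y).
Proof. exact: adj_funP. Qed.

Lemma adj_unique (S T : bop) :
  (forall x y, hdot (T x) y = hdot x (S y)) -> adj T = S.
Proof. by move=> ST; apply/bopP => y; apply: hdot_eqr => w; rewrite -adjP ST. Qed.

Lemma adjK (T : bop) : adj (adj T) = T.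
Proof. by apply: adj_unique => x y; rewrite hdotC -adjP -hdotC. Qed.

Lemma bop_comp_linear (S T : bop) : linear (S \o T).
Proof. by move=> c x y /=; rewrite !linearP. Qed.

Lemma bop_comp_continuous (S T : bop) : continuous (S \o T).
Proof. by move=> x; apply: continuous_comp; exact: bop_continuous. Qed.

Definition bop_comp (S T : bop) : bop :=
  BOp (@bop_comp_linear S T) (@bop_comp_continuous S T).

Lemma adj_comp (S T : bop) : adj (bop_comp S T) = bop_comp (adj T) (adj S).
Proof. by apply: adj_unique => x y /=; rewrite !adjP. Qed.

(* The set is nonempty and bounded, so that [sup] is a genuine supremum. *)
Definition opnorm (T : bop) : R :=
  sup [set hnorm (T x) | x in [set x : H | `|x| <= 1]].

Record saop := SAOp { saop_bop :> bop; saop_adj : adj saop_bop = saop_bop }.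

Lemma saopP (S T : saop) : S =1 T -> S = T.
Proof.
case: S T => [s ls] [t lt] /= /bopP e; subst t.
by congr SAOp; exact: Prop_irrelevance.
Qed.

Lemma saop_hdot (T : saop) x y : hdot (T x) y = hdot x (T y).
Proof. by rewrite adjP saop_adj. Qed.

(* The strong operator topology on self-adjoint operators: the topology of
   pointwise convergence, each value being taken in the norm topology of H. *)
Definition sot_fun (T : saop) : {ptws H -> H} := T.

HB.instance Definition _ := gen_eqMixin saop.
HB.instance Definition _ := gen_choiceMixin saop.
HB.instance Definition _ := Topological.copy saop (initial_topology sot_fun).

(* V^* X V *)

Lemma compress_adj (V : bop) (X : saop) :
  adj (bop_comp (adj V) (bop_comp X V)) = bop_comp (adj V) (bop_comp X V).
Proof.
by rewrite !adj_comp adjK saop_adj; apply/bopP.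
Qed.

Definition compress (V : bop) (X : saop) : saop := SAOp (compress_adj V X).

Record isom := Isom { isom_bop :> bop; isomP : forall x, `|isom_bop x| = `|x| }.

(* An isometry U always satisfies U^* U = 1. *)
Definition unitary (U : isom) := forall y, U (adj U y) = y.

(* A unitary from the n-fold Hilbert direct sum H^n onto H; on H^n the inner
   product is the sum of the inner products of the coordinates. *)
Definition unitary_from_sum n (W : {linear {ffun 'I_n -> H} -> H}) :=
  (forall h k, hdot (W h) (W k) = \sum_(i < n) hdot (h i) (k i)) /\
  (forall y, exists h, W h = y).

End Operators.

Arguments opnorm {R H}.

(* g-tuples of self-adjoint operators, with the product of the strong operator
   topologies. *)
Definition satuple (R : realType) (H : hilbertType R) (g : nat) :=
  {ptws 'I_g -> saop H}.

HB.instance Definition _ (R : realType) (H : hilbertType R) (g : nat) :=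
  Topological.on (satuple H g).

Section SatupleTopology.
Variables (R : realType) (H : hilbertType R) (g : nat).
Lemma sot_cvgP (F : set_system (satuple H g)) {FF : Filter F} (X : satuple H g) :
  F --> X <-> forall (j : 'I_g) (h : H), (fun Y : satuple H g => Y j h) @ F --> X j h.
Proof.
split.
  move=> FX j h.
  have c1 : continuous (fun Y : satuple H g => Y j).
    exact: (@proj_continuous 'I_g (fun=> saop H) j).
  have c2 : continuous (@sot_fun R H) by exact: initial_continuous.
  have c3 : continuous (fun f : {ptws H -> H} => f h).
    exact: (@proj_continuous H (fun=> H) h).
  have cc : continuous (fun Y : satuple H g => sot_fun (Y j) h).
    move=> Y; apply: (continuous_comp (f := fun Y : satuple H g => sot_fun (Y j))) (c3 _).
    by apply: (continuous_comp (f := fun Y : satuple H g => Y j)) (c2 _); exact: c1.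
  apply: cvg_trans (cc X). exact: cvg_app FX.
move=> FX; apply/cvg_sup => j.
move=> A /=.
case=> B [[C oC <-] XC] CA.
case: oC XC CA => D oD <- /= XD DA.
have : F (fun Y : satuple H g => D (sot_fun (Y j))).
  have : (fun Y : satuple H g => sot_fun (Y j)) @ F --> sot_fun (X j).
    apply/cvg_sup => h B' /=.
    case=> B'' [[O oO <-] XO] OB.
    apply: filterS OB _; apply: (FX j h); exact: open_nbhs_nbhs.
  by apply; exact: open_nbhs_nbhs.
exact: filterS DA.
Qed.
End SatupleTopology.

Section Polynomials.
Variables (R : realType) (g : nat).

(* Words are the elements of {fmonom 'I_g}, which coerce to [seq 'I_g]. *)
Definition fpoly := {malg R[i][{fmonom 'I_g}]}.

Definition fvar (j : 'I_g) : fpoly := << fmu j >>.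

Definition fpoly_star (p : fpoly) : fpoly :=
  \sum_(m <- msupp p) << (p@_m)^*%C *g FMonom (rev m) >>.

Record sym_fpoly := SymFPoly {
  sym_poly :> fpoly;
  sym_star : fpoly_star sym_poly = sym_poly }.

Variable H : hilbertType R.

(* The monomial x_{j_1} ... x_{j_k} evaluated at X, applied to h. *)
Definition word_fun (X : satuple H g) (m : seq 'I_g) (h : H) : H :=
  foldr (fun j v => X j v) h m.

Definition poly_fun (p : fpoly) (X : satuple H g) (h : H) : H :=
  \sum_(m <- msupp p) p@_m *: word_fun X m h.

Lemma word_fun_cat X m1 m2 h :
  word_fun X (m1 ++ m2) h = word_fun X m1 (word_fun X m2 h).
Proof. by rewrite /word_fun foldr_cat. Qed.

Lemma word_fun_linear X m : linear (word_fun X m).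
Proof. by move=> c x y; elim: m => //= j m ->; rewrite linearP. Qed.

Lemma word_fun_continuous X m : continuous (word_fun X m).
Proof.
elim: m => [|j m IHm] x; first exact: cvg_id.
exact: (continuous_comp (f := word_fun X m) (g := X j) (IHm x) (@bop_continuous _ _ _ _)).
Qed.

Lemma word_fun_rev X m h k :
  hdot (word_fun X m h) k = hdot h (word_fun X (rev m) k).
Proof.
elim: m h k => //= j m IHm h k.
by rewrite saop_hdot IHm rev_cons -cats1 word_fun_cat.
Qed.

Lemma poly_fun_linear p X : linear (poly_fun p X).
Proof.
move=> c x y; rewrite /poly_fun scaler_sumr -big_split; apply: eq_bigr => m _ /=.
by rewrite word_fun_linear scalerDr !scalerA mulrC.
Qed.

Lemma poly_fun_continuous p X : continuous (poly_fun p X).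
Proof.
rewrite /poly_fun; elim: (finmap.enum_fset _) => [|m s IHs].
  rewrite (_ : (fun _ => _) = cst 0); first by move=> x; exact: cvg_cst.
  by apply/funext => h; rewrite big_nil.
rewrite (_ : (fun _ => _) =
  (fun h => p@_m *: word_fun X m h) \+ (fun h => \sum_(k <- s) p@_k *: word_fun X k h)).
  move=> x; apply: cvgD; last exact: IHs.
  by apply: cvgZl_tmp; exact: word_fun_continuous.
by apply/funext => h; rewrite big_cons.
Qed.

Definition poly_bop (p : fpoly) (X : satuple H g) : bop H :=
  BOp (@poly_fun_linear p X) (@poly_fun_continuous p X).

Lemma poly_funEw (d : finmap.finset_of (Phant {fmonom 'I_g})) p X h :
  finmap.fsubset (msupp p) d ->
  poly_fun p X h = \sum_(m <- d) p@_m *: word_fun X m h.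
Proof.
move=> le; rewrite /poly_fun (finmap.big_fset_incl _ le)// => m _ /mcoeff_outdom ->.
by rewrite scale0r.
Qed.

Lemma poly_funD p q X h : poly_fun (p + q) X h = poly_fun p X h + poly_fun q X h.
Proof.
pose d := finmap.fsetU (msupp (p + q)) (finmap.fsetU (msupp p) (msupp q)).
have h1 : finmap.fsubset (msupp (p + q)) d by exact: finmap.fsubsetUl.
have h2 : finmap.fsubset (msupp p) d.
  exact: finmap.fsubset_trans (finmap.fsubsetUl _ _) (finmap.fsubsetUr _ _).
have h3 : finmap.fsubset (msupp q) d.
  exact: finmap.fsubset_trans (finmap.fsubsetUr _ _) (finmap.fsubsetUr _ _).
rewrite (poly_funEw _ _ h1) (poly_funEw _ _ h2) (poly_funEw _ _ h3).
by rewrite -big_split; apply: eq_bigr => m _ /=; rewrite mcoeffD scalerDl.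
Qed.

Lemma poly_fun0 X h : poly_fun 0 X h = 0.
Proof. by rewrite /poly_fun msupp0 big_nil. Qed.

Lemma poly_funU c m X h : poly_fun << c *g m >> X h = c *: word_fun X m h.
Proof. by rewrite (poly_funEw _ _ msuppU_le) finmap.big_seq_fset1 mcoeffUU. Qed.

Lemma poly_fun_var j X h : poly_fun (fvar j) X h = X j h.
Proof. by rewrite poly_funU scale1r fmU. Qed.

Lemma poly_fun_star p X h k :
  hdot (poly_fun p X h) k = hdot h (poly_fun (fpoly_star p) X k).
Proof.
rewrite /fpoly_star {1}/poly_fun; elim: (finmap.enum_fset _) => [|m s IHs].
  by rewrite !big_nil poly_fun0 linear0r linear0l.
rewrite !big_cons poly_funD hdotDl hdotDr IHs poly_funU hdotZl hdotZr.
by rewrite conjcK word_fun_rev.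
Qed.

Lemma sym_poly_adj (p : sym_fpoly) X : adj (poly_bop p X) = poly_bop p X.
Proof. by apply: adj_unique => x y; rewrite [LHS]poly_fun_star sym_star. Qed.

Definition sym_eval (p : sym_fpoly) (X : satuple H g) : saop H :=
  SAOp (sym_poly_adj p X).

End Polynomials.

Section GammaConvexity.
Variables (R : realType) (H : hilbertType R).

(* Gamma(X) *)
Definition Geval g r (Gamma : 'I_r -> sym_fpoly R g) (X : satuple H g) :
  satuple H r := fun j => sym_eval (Gamma j) X.

(* V^* X V, coordinatewise *)
Definition tcompress g (V : bop H) (X : satuple H g) : satuple H g :=
  fun j => compress V (X j).

Definition tnorm g (X : satuple H g) : R :=
  \big[Order.max/0]_(j < g) opnorm (X j).

Definition tbounded g (K : set (satuple H g)) := has_ubound (@tnorm g @` K).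

(* Z is the image of the direct sum of X_0, ..., X_(n-1) under the
   identification W of H^n with H. *)
Definition is_direct_sum g n (W : {linear {ffun 'I_n -> H} -> H})
    (X : 'I_n -> satuple H g) (Z : satuple H g) :=
  forall (j : 'I_g) (h : {ffun 'I_n -> H}), Z j (W h) = W [ffun i => X i j (h i)].

Definition free_set g (K : set (satuple H g)) :=
  (forall (X : satuple H g) (U : isom H), K X -> unitary U -> K (tcompress U X)) /\
  (forall n (X : 'I_n -> satuple H g) (W : {linear {ffun 'I_n -> H} -> H}) Z,
    (0 < n)%N -> (forall i, K (X i)) -> unitary_from_sum W ->
    is_direct_sum W X Z -> K Z).

Definition Gamma_pair g r (Gamma : 'I_r -> sym_fpoly R g)
    (X : satuple H g) (V : isom H) :=
  tcompress V (Geval Gamma X) = Geval Gamma (tcompress V X).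

Definition Gamma_convex g r (Gamma : 'I_r -> sym_fpoly R g)
    (K : set (satuple H g)) :=
  free_set K /\
  (forall (X : satuple H g) (V : isom H),
    K X -> Gamma_pair Gamma X V -> K (tcompress V X)).

Definition operator_convex g (K : set (satuple H g)) :=
  free_set K /\
  (forall (X : satuple H g) (V : isom H), K X -> K (tcompress V X)).

Definition Gamma_convex_hull g r (Gamma : 'I_r -> sym_fpoly R g)
    (K : set (satuple H g)) : set (satuple H g) :=
  smallest (Gamma_convex Gamma) K.

Definition operator_convex_hull g (K : set (satuple H g)) : set (satuple H g) :=
  smallest (@operator_convex g) K.

Definition infinite_dimensional :=
  forall n (e : 'I_n -> H),
    exists x : H, forall c : 'I_n -> R[i], x != \sum_(i < n) c i *: e i.

Definition separable_space := exists2 D : set H, countable D & dense D.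

End GammaConvexity.

Arguments infinite_dimensional {R}.
Arguments separable_space {R}.

(* Main.v *)
Require Import Defs.
From HB Require Import structures.
From mathcomp Require Import all_boot all_order all_algebra ring lra.
From mathcomp Require Import complex monalg.
From mathcomp Require Import(coercions) finmap.
From mathcomp Require Import all_classical interval_inference reals topology.
From mathcomp Require Import normedtype sequences.

Set Implicit Arguments.
Unset Strict Implicit.
Unset Printing Implicit Defensive.

Import Order.TTheory GRing.Theory Num.Theory numFieldNormedType.Exports.

Local Open Scope classical_set_scope.
Local Open Scope ring_scope.

(* Write C for the set of all S^* Gamma(X) S with X in K and S an isometry.  Free
   sets being stable under direct sums, C is the operator convex hull of Gamma(K),
   and since Gamma starts with the variables, the Gamma-convex hull of K is the
   preimage of C under Gamma; Gamma is SOT-continuous on bounded sets, so it is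
   enough to show that C is closed.

   If Y is in the closure of C, choose an ultrafilter F along which
   Y_t = V_t^* Gamma(X_t) V_t converges to Y.  For an orthonormal basis (e_k) of H,
   the countably many bounded families t |-> w(X_t) V_t e_k, w a word, span an
   infinite-dimensional subspace of the ultrapower of H along F.  Gram-Schmidt in
   the ultrapower gives families (b_k) that are orthonormal in the limit and have
   the same span, and finitely many reflections give unitaries U_t with
   U_t e_k - b_k(t) -> 0.  Then U_t^* V_t and U_t^* X_t U_t converge strongly on
   all of H, to an isometry S and a tuple Z.  Here Z is in K, because K is closed
   and invariant under unitary similarity, and Y = S^* Gamma(Z) S. *)

(** * Convergence in a Hilbert space *)

Section ComplexModulus.
Variable R : realType.
Implicit Types a b : R[i].

(* The modulus of R[i] takes its values in R[i]; [cabs] is the same modulus, in R. *)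
Definition cabs a : R := complex.Re `|a|.

Lemma cabsE a : `|a| = (cabs a)%:C%C.
Proof. by rewrite /cabs RRe_real// normr_real. Qed.

Lemma cabs_ge0 a : 0 <= cabs a.
Proof. by rewrite -ler0c -cabsE. Qed.

Lemma cabs0 : cabs (0 : R[i]) = 0.
Proof. by rewrite /cabs normr0. Qed.

Lemma cabs1 : cabs (1 : R[i]) = 1.
Proof. by rewrite /cabs normr1. Qed.

Lemma cabs_eq0 a : (cabs a == 0) = (a == 0).
Proof. by rewrite -[RHS]normr_eq0 cabsE -(inj_eq (@complexI R)). Qed.

Lemma cabsN a : cabs (- a) = cabs a.
Proof. by rewrite /cabs normrN. Qed.

Lemma cabsM a b : cabs (a * b) = cabs a * cabs b.
Proof. by rewrite {1}/cabs normrM !cabsE -rmorphM. Qed.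

Lemma cabsJ a : cabs a^*%C = cabs a.
Proof. by congr complex.Re; exact: norm_conjC. Qed.

Lemma ler_cabsD a b : cabs (a + b) <= cabs a + cabs b.
Proof. by rewrite -lecR rmorphD /= -!cabsE ler_normD. Qed.

Lemma Re_le_cabs a : complex.Re a <= cabs a.
Proof. exact: Re_le_norm. Qed.

Lemma mulC_cabs a : a * a^*%C = (cabs a ^+ 2)%:C%C.
Proof. exact: Re_mulconj. Qed.

Lemma cabs_i : cabs 'i%C = 1.
Proof. by rewrite /cabs normc_def /= expr0n add0r expr1n sqrtr1. Qed.

Lemma cabs_real (p : R) : cabs p%:C%C = `|p|.
Proof. by rewrite /cabs normc_def /= expr0n addr0 sqrtr_sqr. Qed.

Lemma ler_absRe_cabs a : `|complex.Re a| <= cabs a.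
Proof.
rewrite ler_norml Re_le_cabs andbT lerNl -ReN.
by rewrite (le_trans (Re_le_cabs _))// cabsN.
Qed.

Lemma ler_absIm_cabs a : `|complex.Im a| <= cabs a.
Proof.
have := ler_absRe_cabs ('i%C * a); rewrite cabsM cabs_i mul1r.
by case: a => p q /=; rewrite mul0r mul1r sub0r normrN.
Qed.

Lemma ler_cabs_ReIm a : cabs a <= `|complex.Re a| + `|complex.Im a|.
Proof.
rewrite {1}(complexE a) (le_trans (ler_cabsD _ _))// cabsM.
by rewrite !cabs_real cabs_i mul1r.
Qed.

End ComplexModulus.

Section HilbertConvergence.
Variables (R : realType) (H : hilbertType R).
Implicit Types (x y z : H).

Lemma hnorm0 : hnorm (0 : H) = 0.
Proof. by rewrite /hnorm normr0. Qed.

Lemma hnormN x : hnorm (- x) = hnorm x.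
Proof. by rewrite /hnorm normrN. Qed.

Lemma hdistC x y : hnorm (x - y) = hnorm (y - x).
Proof. by rewrite -hnormN opprB. Qed.

Lemma ler_hnormD x y : hnorm (x + y) <= hnorm x + hnorm y.
Proof. by rewrite -lecR rmorphD /= -!hnormE ler_normD. Qed.

Lemma hnorm0_eq0 x : hnorm x = 0 -> x = 0.
Proof. by move=> x0; apply/normr0_eq0; rewrite hnormE x0. Qed.

Lemma hdotBl x y z : hdot (x - y) z = hdot x z - hdot y z.
Proof. by rewrite hdotDl hdotNl. Qed.

Lemma hdotBr x y z : hdot z (x - y) = hdot z x - hdot z y.
Proof. by rewrite hdotDr hdotNr. Qed.

Lemma hdot_self_eq1 x : hdot x x = 1 -> hnorm x = 1.
Proof.
rewrite hnorm2E => /(congr1 (@complex.Re R)) /= x1.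
by apply/eqP; rewrite -(eqrXn2 (n := 2)) ?hnorm_ge0// expr1n x1.
Qed.

Lemma cabs_hdot x y : cabs (hdot x y) <= hnorm x * hnorm y.
Proof. exact: hdot_CSr. Qed.

Lemma hnorm_scale (a : R[i]) x : hnorm (a *: x) = cabs a * hnorm x.
Proof. exact: hnormZ. Qed.

Section Filter.
Variables (T : Type) (F : set_system T).
Context {FF : Filter F}.

Lemma hcvgP (u : T -> H) l : u @ F --> l <->
  forall e : R, 0 < e -> \forall t \near F, hnorm (u t - l) < e.
Proof.
split.
  move=> /cvgrPdist_lt ul e e0; have := ul e%:C%C; rewrite ltcR => /(_ e0).
  by apply: filterS => t; rewrite hnormE ltcR hdistC.
move=> ul; apply/cvgrPdist_lt => e e0.
have eE : e = (complex.Re e)%:C%C by rewrite RRe_real// gtr0_real.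
have {}e0 : 0 < complex.Re e by rewrite -ltcR -eE.
by have := ul _ e0; apply: filterS => t; rewrite hnormE eE ltcR hdistC.
Qed.

Lemma hcvg_subP (u : T -> H) l : u @ F --> l <-> (fun t => u t - l) @ F --> (0 : H).
Proof. by split=> /hcvgP h; apply/hcvgP => e /h; apply: filterS => t; rewrite subr0. Qed.

Lemma hcvg0_le (M : R) (u v : T -> H) : v @ F --> (0 : H) ->
  (\forall t \near F, hnorm (u t) <= M * hnorm (v t)) -> u @ F --> (0 : H).
Proof.
move=> /hcvgP v0 uv; apply/hcvgP => e e0.
(* The sign of [M] is free, hence the divisor [|M| + 1]. *)
have M0 : 0 < `|M| + 1 by rewrite ltr_wpDl.
have := v0 _ (divr_gt0 e0 M0); apply: filterS2 uv => t uv.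
rewrite !subr0 ltr_pdivlMr// => vt; apply: le_lt_trans vt.
rewrite (le_trans uv)// mulrC ler_wpM2l ?hnorm_ge0//.
by rewrite (le_trans (ler_norm _))// lerDl.
Qed.

Lemma hcvg0P (u : T -> H) : u @ F --> (0 : H) <-> hnorm (u t) @[t --> F] --> (0 : R).
Proof.
split=> [/hcvgP u0|/cvgrPdist_lt u0].
  apply/cvgrPdist_lt => e /u0; apply: filterS => t.
  by rewrite sub0r normrN subr0 ger0_norm ?hnorm_ge0.
apply/hcvgP => e /u0; apply: filterS => t.
by rewrite sub0r normrN subr0 ger0_norm ?hnorm_ge0.
Qed.

Lemma hcvgD (u v : T -> H) a b : u @ F --> a -> v @ F --> b ->
  (fun t => u t + v t) @ F --> a + b.
Proof. exact: cvgD. Qed.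

Lemma hcvgB (u v : T -> H) a b : u @ F --> a -> v @ F --> b ->
  (fun t => u t - v t) @ F --> a - b.
Proof. exact: cvgB. Qed.

Lemma hcvgZ (c : R[i]) (u : T -> H) a : u @ F --> a ->
  (fun t => c *: u t) @ F --> c *: a.
Proof. exact: cvgZl_tmp. Qed.

Lemma hcvg_sum (I : Type) (s : seq I) (u : I -> T -> H) (a : I -> H) :
  (forall i, u i @ F --> a i) ->
  (fun t => \sum_(i <- s) u i t) @ F --> \sum_(i <- s) a i.
Proof.
move=> ua; elim: s => [|i s IHs].
  by rewrite big_nil (_ : (fun _ => _) = cst 0); [exact: cvg_cst|apply/funext=> t; rewrite big_nil].
rewrite big_cons (_ : (fun _ => _) = fun t => u i t + \sum_(i <- s) u i t); last first.
  by apply/funext=> t; rewrite big_cons.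
exact: hcvgD.
Qed.

Lemma hcvg0_bound (v : T -> H) (u : T -> R) :
  (\forall t \near F, hnorm (v t) <= u t) -> u @ F --> (0 : R) -> v @ F --> (0 : H).
Proof.
move=> vu /cvgrPdist_lt u0; apply/hcvgP => e /u0; apply: filterS2 vu => t vu.
by rewrite sub0r normrN subr0; apply: le_lt_trans; rewrite (le_trans vu)// ler_norm.
Qed.

(* Convergence in R[i], expressed by the modulus since [-->] finds no topology on the
   type [R[i]] of the values of [hdot]. *)
Definition ccvg (c : T -> R[i]) (l : R[i]) :=
  (cabs (c t - l) @[t --> F] --> (0 : R)).

Lemma ccvg_bound (c : T -> R[i]) (l : R[i]) (u : T -> R) :
  (\forall t \near F, cabs (c t - l) <= u t) -> u @ F --> (0 : R) -> ccvg c l.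
Proof.
move=> cu u0; apply: (squeeze_cvgr _ (cvg_cst 0) u0).
by apply: filterS cu => t ->; rewrite cabs_ge0.
Qed.

Lemma ccvg_ext (c d : T -> R[i]) (l : R[i]) : ccvg c l -> c =1 d -> ccvg d l.
Proof. by move=> + /funext <-. Qed.

Lemma ccvg_near_ext (c d : T -> R[i]) (l : R[i]) : ccvg c l ->
  (\forall t \near F, c t = d t) -> ccvg d l.
Proof. by move=> + cd; apply: ccvg_bound; apply: filterS cd => t ->. Qed.

Lemma ccvg_real (u : T -> R) (l : R) : u @ F --> l ->
  ccvg (fun t => (u t)%:C%C) l%:C%C.
Proof.
move=> ul; apply: (@ccvg_bound _ _ (fun t => `|u t - l|)).
  by apply: nearW => t; rewrite -rmorphB cabs_real.
by apply/norm_cvg0P; rewrite -(subrr l); apply: cvgB => //; exact: cvg_cst.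
Qed.

Lemma ccvg_cst (l : R[i]) : ccvg (fun=> l) l.
Proof.
rewrite /ccvg (_ : (fun _ => _) = cst 0); first exact: cvg_cst.
by apply/funext => t; rewrite subrr cabs0.
Qed.

Lemma ccvgD (c d : T -> R[i]) (l m : R[i]) : ccvg c l -> ccvg d m ->
  ccvg (fun t => c t + d t) (l + m).
Proof.
move=> cl dm; apply: (@ccvg_bound _ _ (fun t => cabs (c t - l) + cabs (d t - m))).
  by apply: nearW => t; rewrite opprD addrACA ler_cabsD.
by rewrite -[0]addr0; apply: cvgD.
Qed.

Lemma ccvgMl (a : R[i]) (c : T -> R[i]) (l : R[i]) : ccvg c l ->
  ccvg (fun t => a * c t) (a * l).
Proof.
move=> cl; apply: (@ccvg_bound _ _ (fun t => cabs a * cabs (c t - l))).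
  by apply: nearW => t; rewrite -mulrBr cabsM.
by rewrite -[0](mulr0 (cabs a)); apply: cvgM => //; exact: cvg_cst.
Qed.

Lemma ccvgB (c d : T -> R[i]) (l m : R[i]) : ccvg c l -> ccvg d m ->
  ccvg (fun t => c t - d t) (l - m).
Proof.
move=> cl /(ccvgMl (-1)) dm; have := ccvgD cl dm; rewrite mulN1r.
by congr ccvg; apply/funext => t; rewrite mulN1r.
Qed.

Lemma ccvgJ (c : T -> R[i]) (l : R[i]) : ccvg c l ->
  ccvg (fun t => (c t)^*%C) l^*%C.
Proof.
apply: ccvg_bound; apply: nearW => t.
by rewrite -rmorphB cabsJ.
Qed.

(** The bounded vectors [v t] need not converge, so only the difference of the two scalings can be
    claimed to have a limit. *)
Lemma hcvgZr (a : T -> R[i]) (l : R[i]) (M : R) (v : T -> H) : ccvg a l ->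
  (forall t, hnorm (v t) <= M) -> (fun t => a t *: v t - l *: v t) @ F --> (0 : H).
Proof.
move=> al vM; apply: (@hcvg0_bound _ (fun t => cabs (a t - l) * M)).
  by apply: nearW => t; rewrite -scalerBl hnorm_scale ler_wpM2l ?cabs_ge0.
by rewrite -[0](mul0r M); apply: cvgM => //; exact: cvg_cst.
Qed.

Lemma ccvg0_hdot (M : R) (u v : T -> H) : u @ F --> (0 : H) ->
  (\forall t \near F, hnorm (v t) <= M) -> ccvg (fun t => hdot (u t) (v t)) 0.
Proof.
move=> /hcvg0P u0 vM; apply: (@ccvg_bound _ _ (fun t => hnorm (u t) * M)).
  apply: filterS vM => t vM.
  by rewrite subr0 (le_trans (cabs_hdot _ _))// ler_wpM2l ?hnorm_ge0.
by rewrite -[0](mul0r M); apply: cvgM => //; exact: cvg_cst.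
Qed.

Lemma hcvg_bounded (u : T -> H) a : u @ F --> a ->
  \forall t \near F, hnorm (u t) <= hnorm a + 1.
Proof.
move=> /hcvgP/(_ _ ltr01); apply: filterS => t ut.
by rewrite -[u t](subrK a) addrC (le_trans (ler_hnormD _ _))// lerD2l ltW.
Qed.

(** Split [<u, v> - <a, b>] as [<u - a, v> + <a, v - b>]; a convergent [v] is eventually bounded. *)
Lemma ccvg_hdot (u v : T -> H) a b : u @ F --> a -> v @ F --> b ->
  ccvg (fun t => hdot (u t) (v t)) (hdot a b).
Proof.
move=> /hcvg_subP ua /[dup] /hcvg_bounded vb /hcvg_subP va.
have h1 := ccvg0_hdot ua vb.
have h2 : ccvg (fun t => hdot a (v t - b)) 0.
  have aM : \forall t \near F, hnorm ((fun=> a) t) <= hnorm a by exact: nearW.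
  have /ccvgJ := ccvg0_hdot va aM; rewrite conjc0.
  by congr ccvg; apply/funext => t; rewrite -hdotC.
have := ccvgD (ccvgD h1 h2) (ccvg_cst (hdot a b)); rewrite !add0r.
by congr ccvg; apply/funext => t; rewrite hdotBl hdotBr addrA !subrK.
Qed.

End Filter.

Lemma ccvg_unique (T : Type) (F : set_system T) {FF : ProperFilter F}
  (c : T -> R[i]) (l m : R[i]) : ccvg F c l -> ccvg F c m -> l = m.
Proof.
move=> cl cm; have := ccvgB cl cm; rewrite /ccvg.
rewrite (_ : (fun t => _) = fun=> cabs (l - m)); last first.
  by apply/funext => t; rewrite subrr sub0r cabsN.
move=> lm; apply/eqP; rewrite -subr_eq0 -cabs_eq0; apply/eqP.
have lm2 : (fun=> cabs (l - m)) @ F --> cabs (l - m) by exact: cvg_cst.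
exact: (norm_cvg_unique lm2 (lm _)).
Qed.

Lemma hcvg_unique (T : Type) (F : set_system T) {FF : ProperFilter F}
  (u : T -> H) (a b : H) : u @ F --> a -> u @ F --> b -> a = b.
Proof. by move=> ua ub; exact: (norm_cvg_unique ua ub). Qed.
End HilbertConvergence.

(** * Isometries and unitaries *)

Section OperatorFacts.
Variables (R : realType) (H : hilbertType R).
Implicit Types (x y z : H) (S T : bop H) (U V : isom H).

Lemma bopB T x y : T (x - y) = T x - T y.
Proof. exact: linearB. Qed.

Lemma bop_of_bounded (f : H -> H) (M : R) : linear f ->
  (forall x, hnorm (f x) <= M * hnorm x) -> exists B : bop H, B =1 f.
Proof.
move=> fl fM.
pose L : {linear H -> H} := HB.pack f (GRing.isLinear.Build R[i] H H *:%R f fl).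
by exists (BOp fl (@linear_hnorm_continuous R H L M fM)).
Qed.

Lemma hnorm_adj_le (M : R) T : (forall x, hnorm (T x) <= M * hnorm x) ->
  forall x, hnorm (adj T x) <= M * hnorm x.
Proof.
(* The main case divides [|T^* x|^2 = <T T^* x, x> <= M |T^* x| |x|] by [|T^* x|]. If [T^* x]
   vanishes, [0 <= M |x|] has to come from the bound on [T x]. *)
move=> TM x; have [a0|a0] := leP (hnorm (adj T x)) 0.
  have xM := TM (adj T x); have a1 : hnorm (adj T x) = 0.
    by apply/le_anti; rewrite a0 hnorm_ge0.
  rewrite a1; have [->|x0] := eqVneq (hnorm x) 0; first by rewrite mulr0.
  rewrite -(@pmulr_lge0 _ (hnorm x)) ?lt_def ?x0 ?hnorm_ge0//.
  rewrite mulrAC pmulr_lge0 ?lt_def ?x0 ?hnorm_ge0//.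
  exact: le_trans (hnorm_ge0 _) (TM x).
rewrite -(ler_pM2l a0) -expr2 -[leLHS]ReC -hnorm2E.
rewrite -adjP (le_trans (Re_le_cabs _))// (le_trans (cabs_hdot _ _))//.
by rewrite mulrA [_ * M]mulrC ler_wpM2r ?hnorm_ge0.
Qed.

Lemma hnorm_isom V x : hnorm (V x) = hnorm x.
Proof. by rewrite /hnorm isomP. Qed.

(** The defect [d z] is purely imaginary because norms are preserved at [x + z]. It is
    conjugate-linear in [z], so at [d y *: y] it equals the real number [|d y|^2], which is
    therefore zero. *)
Lemma hdot_isom V x y : hdot (V x) (V y) = hdot x y.
Proof.
pose d z := hdot (V x) (V z) - hdot x z.
have d0 z : d z + (d z)^*%C = 0.
  have := hnorm2E (V (x + z)); rewrite hnorm_isom -hnorm2E linearD !hdotDl !hdotDr.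
  rewrite !hnorm2E !hnorm_isom -!hnorm2E (hdotC (V z) (V x)) (hdotC z x).
  rewrite /d rmorphB /=; move: (hdot (V x) (V z)) (hdot x z) => p q e.
  apply: (@addIr _ (hdot x x + q + (q^*%C + hdot z z))); rewrite add0r -[RHS]e.
  by ring.
have dZ : d (d y *: y) = (cabs (d y) ^+ 2)%:C%C.
  by rewrite {1}/d linearZ /= !hdotZr -mulrBr mulrC mulC_cabs.
have := d0 (d y *: y); rewrite dZ.
rewrite conjc_real -rmorphD => /(congr1 (@complex.Re R)) /= /eqP.
rewrite -mulr2n mulrn_eq0 /= sqrf_eq0 cabs_eq0 /d subr_eq0.
by move/eqP.
Qed.

Lemma isomK V x : adj V (V x) = x.
Proof. by apply: hdot_eqr => w; rewrite -adjP hdot_isom. Qed.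

Lemma hnorm_adj_isom V x : hnorm (adj V x) <= hnorm x.
Proof.
rewrite -[leRHS]mul1r; apply: hnorm_adj_le => y.
by rewrite mul1r hnorm_isom.
Qed.

Lemma isom_of_hnorm T : (forall x, hnorm (T x) = hnorm x) -> exists V, V =1 T.
Proof.
move=> TE.
have Ti x : `|T x| = `|x| by rewrite !hnormE TE.
by exists (Isom Ti).
Qed.

Lemma isom_id : exists V, V =1 id.
Proof.
have [|x|B BE] := @bop_of_bounded id 1; first by move=> c x y.
  by rewrite mul1r.
have [x|V VE] := @isom_of_hnorm B; first by rewrite BE.
by exists V => x; rewrite VE BE.
Qed.

Lemma isom_comp U V : exists W : isom H, W =1 U \o V.
Proof.
by have [x|W] := @isom_of_hnorm (bop_comp U V); [rewrite /= !hnorm_isom|exists W].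
Qed.

Lemma adj_ext S T : S =1 T -> adj S =1 adj T.
Proof. by move=> /bopP ->. Qed.

Lemma adj_comp_ext U V (W : isom H) : W =1 U \o V -> adj W =1 adj V \o adj U.
Proof.
by move=> WE x; rewrite (@adj_ext W (bop_comp U V) WE) adj_comp.
Qed.

Lemma hnorm_adj_unitary U x : unitary U -> hnorm (adj U x) = hnorm x.
Proof. by move=> uU; rewrite -(hnorm_isom U) uU. Qed.

Lemma unitary_isom_comp U V (W : isom H) : W =1 U \o V ->
  unitary U -> unitary V -> unitary W.
Proof. by move=> WE uU uV x; rewrite WE (adj_comp_ext WE) /= uV uU. Qed.

(* The unitary sending the unit vector b to the unit vector u is the complex
   reflection x - c <x, v> v with v = b - u and c = 1 / <b, v>; it is unitary
   because c + c^* = |c|^2 |v|^2. *)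
Lemma reflection_unitary b u : hnorm b = 1 -> hnorm u = 1 ->
  exists U, [/\ unitary U, U b = u &
    forall x, hdot x b = 0 -> hdot x u = 0 -> U x = x].
Proof.
move=> b1 u1; have [<-|bu] := eqVneq b u.
  have [V VE] := isom_id; exists V; split; [|exact: VE|by move=> x _ _; exact: VE].
  by move=> x; rewrite VE -[in RHS](isomK V x) VE.
have [v vE] : exists v, v = b - u by exists (b - u).
have [c cvE] : exists c, c = (hdot b v)^-1 by exists (hdot b v)^-1.
have bb : hdot b b = 1 by rewrite hnorm2E b1 expr1n.
have uu : hdot u u = 1 by rewrite hnorm2E u1 expr1n.
have vv : hdot v v = hdot b v + (hdot b v)^*%C.
  by rewrite vE !(hdotBr, hdotBl) bb uu (hdotC u b) rmorphB rmorph1 /=; ring.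
(* Since [<v, v>] is twice the real part of [<b, v>], vanishing of the latter would force
   [b = u]. *)
have v0 : hdot b v != 0.
  apply/eqP => bv0; move/eqP: bu; apply; apply/eqP; rewrite -subr_eq0 -vE.
  by rewrite -(dnorm_eq0 hdot) vv bv0 conjc0 addr0.
have v0' : (hdot b v)^*%C != 0 by rewrite conjc_eq0.
pose f (a : R[i]) x : H := x - (a * hdot x v) *: v.
have fl a : linear (f a).
  by move=> k x y; rewrite /f hdotDl hdotZl scalerBr scalerA mulrDr scalerDl mulrCA opprD addrACA.
have fM a x : hnorm (f a x) <= (1 + cabs a * hnorm v * hnorm v) * hnorm x.
  rewrite (le_trans (ler_hnormD _ _))// hnormN hnorm_scale mulrDl mul1r lerD2l.
  rewrite cabsM -!mulrA ler_wpM2l ?cabs_ge0// [hnorm v * hnorm x]mulrC mulrA.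
  by rewrite [leRHS]mulrC [hnorm v * (_ * _)]mulrC ler_wpM2r ?hnorm_ge0// mulrC cabs_hdot.
have [B BE] := bop_of_bounded (fl c) (fM c).
have [B' BE'] := bop_of_bounded (fl c^*%C) (fM c^*%C).
have adjB : adj B = B'.
  apply: adj_unique => x y; rewrite BE BE' /f hdotBl hdotBr hdotZl hdotZr.
  by rewrite rmorphM /= conjcK -hdotC mulrAC.
(* Taken at [a = c] and at the conjugate of [c], this makes [B'] a two-sided inverse of [B]. *)
have ff a x : a + a^*%C = a * a^*%C * hdot v v -> f a (f a^*%C x) = x.
  move=> aE; rewrite /f hdotBl hdotZl -!addrA -opprD -scalerDl.
  suff -> : a^*%C * hdot x v + a * (hdot x v - a^*%C * hdot x v * hdot v v) = 0.
    by rewrite scale0r subr0.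
  rewrite (_ : _ + _ = (a + a^*%C - a * a^*%C * hdot v v) * hdot x v); last by ring.
  by rewrite aE subrr mul0r.
have cE : c + c^*%C = c * c^*%C * hdot v v.
  rewrite vv cvE rmorphV ?unitfE//=; field; by rewrite v0 v0'.
have BB' x : B (B' x) = x by rewrite BE BE' ff.
have B'B x : B' (B x) = x.
  rewrite BE BE'; have := ff c^*%C x; rewrite conjcK; apply.
  by rewrite addrC cE [c * _]mulrC.
have [x|U UE] := @isom_of_hnorm B.
  apply/eqP; rewrite -(eqrXn2 (n := 2)) ?hnorm_ge0// -(inj_eq (@complexI R)) -!hnorm2E.
  by rewrite adjP adjB B'B.
exists U; split.
- by move=> x; rewrite UE (adj_ext UE) adjB BB'.
- by rewrite UE BE /f cvE mulVf// scale1r vE opprB addrC subrK.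
- by move=> x xb xu; rewrite UE BE /f vE hdotBr xb xu subrr mulr0 scale0r subr0.
Qed.

End OperatorFacts.

(** * Polynomials, compressions and direct sums *)

Section Tuples.
Variables (R : realType) (H : hilbertType R) (g : nat).
Implicit Types (X Y Z : satuple H g) (U V : isom H).

Lemma tcompressE V X j h : tcompress V X j h = adj V (X j (V h)).
Proof. by []. Qed.

Lemma satupleP X Y : (forall j h, X j h = Y j h) -> X = Y.
Proof. by move=> XY; apply/funext => j; apply/saopP => h; exact: XY. Qed.

Lemma tcompress_comp U V (W : isom H) X : W =1 U \o V ->
  tcompress W X = tcompress V (tcompress U X).
Proof.
by move=> WE; apply: satupleP => j h; rewrite !tcompressE (adj_comp_ext WE) /= WE.
Qed.

Lemma hnorm_compress_le (M : R) V (A : saop H) h :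
  (forall x, hnorm (A x) <= M * hnorm x) -> hnorm (compress V A h) <= M * hnorm h.
Proof.
move=> AM; apply: le_trans (hnorm_adj_isom V (A (V h))) _.
by rewrite -(hnorm_isom V h).
Qed.

(** The source [L] is an arbitrary module so that [A] can be the adjoint of a unitary as well as an
    identification of a direct sum with [H]. *)
Lemma word_fun_intertwine (L : lmodType R[i]) (A : {linear L -> H})
    (Y : 'I_g -> L -> L) X : (forall j h, X j (A h) = A (Y j h)) ->
  forall m h, word_fun X m (A h) = A (foldr Y h m).
Proof. by move=> XY m h; elim: m => //= j m ->. Qed.

Lemma poly_fun_intertwine (L : lmodType R[i]) (A : {linear L -> H})
    (Y : 'I_g -> L -> L) X : (forall j h, X j (A h) = A (Y j h)) ->
  forall p h, poly_fun p X (A h) = A (\sum_(m <- msupp p) p@_m *: foldr Y h m).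
Proof.
move=> XY p h; rewrite /poly_fun linear_sum; apply: eq_bigr => m _.
by rewrite (word_fun_intertwine XY) linearZ.
Qed.

(** Unitarity cancels [U U^*] between consecutive letters of a word. For a mere isometry this
    identity is a condition, that of a Gamma-pair. *)
Lemma poly_fun_compress U X p h : unitary U ->
  poly_fun p (tcompress U X) h = adj U (poly_fun p X (U h)).
Proof.
move=> uU; rewrite -[in LHS](isomK U h).
by rewrite (@poly_fun_intertwine H (adj U) X)// => j k; rewrite tcompressE uU.
Qed.

Lemma poly_fun_direct_sum n (W : {linear {ffun 'I_n -> H} -> H})
    (X : 'I_n -> satuple H g) Z p h : is_direct_sum W X Z ->
  poly_fun p Z (W h) = W [ffun i => poly_fun p (X i) (h i)].
Proof.
move=> WXZ; rewrite (@poly_fun_intertwine _ W (fun j h => [ffun i => X i j (h i)]))//.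
congr (W _); apply/ffunP => i; rewrite sum_ffunE ffunE; apply: eq_bigr => m _.
rewrite ffunE; congr (_ *: _); rewrite /word_fun.
by elim: (m : seq _) => //= j s <-; rewrite ffunE.
Qed.

Variables (r : nat) (Gamma : 'I_r -> sym_fpoly R g).

Lemma Geval_compress U X : unitary U ->
  Geval Gamma (tcompress U X) = tcompress U (Geval Gamma X).
Proof.
by move=> uU; apply/funext => j; apply/saopP => h; exact: poly_fun_compress.
Qed.

Lemma Geval_direct_sum n (W : {linear {ffun 'I_n -> H} -> H})
    (X : 'I_n -> satuple H g) Z : is_direct_sum W X Z ->
  is_direct_sum W (fun i => Geval Gamma (X i)) (Geval Gamma Z).
Proof. by move=> WXZ j h; exact: poly_fun_direct_sum. Qed.

End Tuples.

Section DirectSums.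
Variables (R : realType) (H : hilbertType R) (n : nat).
Variables (W : {linear {ffun 'I_n -> H} -> H}) (uW : unitary_from_sum W).
Implicit Types (h k : {ffun 'I_n -> H}).

Lemma hdot_sumE h k : hdot (W h) (W k) = \sum_(i < n) hdot (h i) (k i).
Proof. exact: uW.1. Qed.

Lemma hnorm2_sumE h : hnorm (W h) ^+ 2 = \sum_(i < n) hnorm (h i) ^+ 2.
Proof.
apply: (@complexI R); rewrite -hnorm2E hdot_sumE rmorph_sum.
by apply: eq_bigr => i _; rewrite hnorm2E.
Qed.

Lemma sum_identification_inj : injective W.
Proof.
move=> h k hk; apply/ffunP => i; apply/eqP; rewrite -subr_eq0; apply/eqP/hnorm0_eq0.
have : hnorm (W (h - k)) ^+ 2 = 0 by rewrite linearB hk subrr hnorm0 expr0n.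
rewrite hnorm2_sumE => /eqP; rewrite psumr_eq0 => [/allP/(_ i)|j _]; last exact: sqr_ge0.
by rewrite mem_index_enum sqrf_eq0 !ffunE => /(_ isT)/eqP.
Qed.

Lemma direct_sum_bop (A : 'I_n -> bop H) :
  exists B : bop H, forall h, B (W h) = W [ffun i => A i (h i)].
Proof.
(* [W] is onto by definition and injective because it preserves norms, so [Wi] is its inverse. *)
have /choice[Wi WiK] : forall y, exists h, W h = y by exact: uW.2.
have WK h : Wi (W h) = h by apply: sum_identification_inj; rewrite WiK.
have /choice[M AM] : forall i, exists M : R, 0 <= M /\ forall x, hnorm (A i x) <= M * hnorm x.
  by move=> i; have [M M0 AM] := bop_bounded (A i); exists M.
have M0 : 0 <= \sum_(i < n) M i by apply: sumr_ge0 => i _; case: (AM i).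
have [||B BE] := @bop_of_bounded R H (fun y => W [ffun i => A i (Wi y i)]) (\sum_(i < n) M i).
- move=> c x y; rewrite -linearP; congr (W _).
  have -> : Wi (c *: x + y) = c *: Wi x + Wi y.
    by apply: sum_identification_inj; rewrite linearP !WiK.
  by apply/ffunP => i; rewrite !ffunE linearP.
- move=> y; rewrite -(@ler_pXn2r _ 2) ?nnegrE ?mulr_ge0 ?hnorm_ge0// exprMn.
  rewrite -[in leRHS](WiK y) !hnorm2_sumE mulr_sumr; apply: ler_sum => i _.
  rewrite ffunE -exprMn ler_pXn2r ?nnegrE ?mulr_ge0 ?hnorm_ge0//.
  rewrite (le_trans ((AM i).2 _))// ler_wpM2r ?hnorm_ge0// (bigD1 i)//= lerDl.
  by apply: sumr_ge0 => j _; case: (AM j).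
by exists B => h; rewrite BE WK.
Qed.

Lemma direct_sum_adj (A : 'I_n -> bop H) (B : bop H) :
  (forall h, B (W h) = W [ffun i => A i (h i)]) ->
  forall h, adj B (W h) = W [ffun i => adj (A i) (h i)].
Proof.
move=> BE h; apply: hdot_eqr => w; have [k <-] := uW.2 w.
by rewrite -adjP BE !hdot_sumE; apply: eq_bigr => i _; rewrite !ffunE adjP.
Qed.

Lemma direct_sum_isom (V : 'I_n -> isom H) :
  exists S : isom H, forall h, S (W h) = W [ffun i => V i (h i)].
Proof.
have [B BE] := direct_sum_bop V.
have [y|S SE] := @isom_of_hnorm R H B; last by exists S => h; rewrite SE.
have [h <-] := uW.2 y.
apply/eqP; rewrite BE -(eqrXn2 (n := 2)) ?hnorm_ge0// !hnorm2_sumE; apply/eqP.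
by apply: eq_bigr => i _; rewrite ffunE hnorm_isom.
Qed.

Lemma direct_sum_exists g (X : 'I_n -> satuple H g) :
  exists Z : satuple H g, is_direct_sum W X Z.
Proof.
suff /choice[Z ZE] : forall j, exists A : saop H,
    forall h, A (W h) = W [ffun i => X i j (h i)] by exists Z.
move=> j; have [B BE] := direct_sum_bop (fun i => X i j).
have adjB : adj B = B.
  apply/bopP => y; have [h <-] := uW.2 y; rewrite (direct_sum_adj BE) BE.
  by congr (W _); apply/ffunP => i; rewrite !ffunE saop_adj.
by exists (SAOp adjB).
Qed.

End DirectSums.

(** * Operator convex hulls as sets of compressions *)

Section Hulls.
Variables (R : realType) (H : hilbertType R).

Lemma operator_convex_hull_convex g (L : set (satuple H g)) :
  operator_convex (operator_convex_hull L).
Proof.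
split; first split.
- by move=> X U LX uU D /[dup] oD [[[DU DW] DV] LD]; apply: DU => //; exact: LX oD.
- move=> n X W Z n0 LX uW WXZ D /[dup] oD [[[DU DW] DV] LD].
  by apply: DW WXZ => // i; exact: LX i _ oD.
- by move=> X V LX D /[dup] oD [[Df DV] LD]; apply: DV; exact: LX oD.
Qed.

(** The compressions of points of [L] already form an operator convex set: compressing twice is
    compressing along the composed isometry, and a direct sum of compressions is the compression of
    a direct sum along the direct sum of the isometries. *)
Lemma operator_convex_hullE g (L : set (satuple H g)) :
  (forall (X : satuple H g) (U : isom H), L X -> unitary U -> L (tcompress U X)) ->
  (forall n (X : 'I_n -> satuple H g) (W : {linear {ffun 'I_n -> H} -> H}),
    (0 < n)%N -> (forall i, L (X i)) -> unitary_from_sum W ->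
    exists2 Z, L Z & is_direct_sum W X Z) ->
  operator_convex_hull L = [set Y | exists2 X, L X & exists V : isom H, Y = tcompress V X].
Proof.
move=> LU LW; apply/seteqP; split=> [Y|Y [X LX [V ->]]]; last first.
  by move=> C [[_ CV] LC]; apply: CV; exact: LC.
apply; split; last first.
  move=> X LX; exists X => //; have [V VE] := isom_id H; exists V.
  by apply: satupleP => j h; rewrite tcompressE VE -[LHS](isomK V) VE.
have CC (X : satuple H g) (V : isom H) :
    (exists2 Z, L Z & exists V : isom H, X = tcompress V Z) ->
    exists2 Z, L Z & exists V' : isom H, tcompress V X = tcompress V' Z.
  move=> [Z LZ [U ->]]; exists Z => //; have [W WE] := isom_comp U V.
  by exists W; rewrite (tcompress_comp Z WE).
split=> //; split=> [X U CX _|n X W Z n0 CX uW WXZ]; first exact: CC.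
have /choice[P PE] : forall i, exists P : satuple H g * isom H,
    L P.1 /\ X i = tcompress P.2 P.1.
  by move=> i; have [Z' LZ' [V ->]] := CX i; exists (Z', V).
have [Q LQ QE] := LW n (fun i => (P i).1) W n0 (fun i => (PE i).1) uW.
have [S SE] := direct_sum_isom uW (fun i => (P i).2).
exists Q => //; exists S; apply: satupleP => j y; have [h <-] := uW.2 y.
rewrite WXZ tcompressE SE QE (direct_sum_adj uW SE); congr (W _); apply/ffunP => i.
by rewrite !ffunE (PE i).2.
Qed.

End Hulls.

(** * Strong limits *)

Section StrongLimits.
Variables (R : realType) (H : hilbertType R).

(** Quantifying over all linear subspaces [D] avoids naming the span, and applies at once to
    subspaces such as the set of points where a family of operators converges. *)
Definition total (b : nat -> H) := forall D : set H, D 0 ->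
  (forall (c : R[i]) x y, D x -> D y -> D (c *: x + y)) -> (forall k, D (b k)) ->
  forall x (e : R), 0 < e -> exists2 y, D y & hnorm (x - y) < e.

Variables (T : Type) (F : set_system T).

(** Write [A_t u_t - B a = A_t (u_t - a) + (A_t a - B a)]; the uniform bound controls the first
    term. This is why products, hence polynomials, are strongly continuous on bounded sets. *)
Lemma cvg_bop_app {FF : Filter F} (A : T -> H -> H) (B : H -> H) (M : R) :
  (\forall t \near F, forall x, hnorm (A t x) <= M * hnorm x) ->
  (forall t, linear (A t)) ->
  (forall x, A t x @[t --> F] --> B x) ->
  forall (u : T -> H) a, u @ F --> a -> A t (u t) @[t --> F] --> B a.
Proof.
move=> AM Al AB u a /hcvg_subP ua; apply/hcvg_subP.
rewrite (_ : (fun t => _) = fun t => A t (u t - a) + (A t a - B a)); last first.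
  apply/funext => t; rewrite addrA; congr (_ - _).
  have /= := Al t 1 (u t - a) a; rewrite !scale1r subrK => <-.
  by congr (A t _); rewrite subrK.
have Aua : A t (u t - a) @[t --> F] --> (0 : H).
  by apply: (@hcvg0_le _ _ _ _ _ M _ _ ua); apply: filterS AM => t; exact.
have /hcvg_subP Aa := AB a.
by have := hcvgD Aua Aa; rewrite addr0; exact.
Qed.

Lemma word_fun_cvg {FF : Filter F} g (Z : T -> satuple H g) (X : satuple H g) (M : R) :
  (\forall t \near F, forall j h, hnorm (Z t j h) <= M * hnorm h) ->
  (forall j h, Z t j h @[t --> F] --> X j h) ->
  forall m (u : T -> H) a, u @ F --> a ->
    word_fun (Z t) m (u t) @[t --> F] --> word_fun X m a.
Proof.
move=> ZM ZX m u a ua; elim: m => //= j m IHm.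
apply: (@cvg_bop_app FF (fun t => Z t j) (X j) M) IHm => //.
- by apply: filterS ZM => t.
- by move=> t; exact: bop_linear.
Qed.

Lemma poly_fun_cvg {FF : Filter F} g (Z : T -> satuple H g) (X : satuple H g) (M : R) :
  (\forall t \near F, forall j h, hnorm (Z t j h) <= M * hnorm h) ->
  (forall j h, Z t j h @[t --> F] --> X j h) ->
  forall p (u : T -> H) a, u @ F --> a ->
    poly_fun p (Z t) (u t) @[t --> F] --> poly_fun p X a.
Proof.
move=> ZM ZX p u a ua; rewrite /poly_fun.
apply: (@hcvg_sum R H T F _ _ _ (fun m t => p@_m *: word_fun (Z t) m (u t))) => m.
by apply: hcvgZ; exact: (word_fun_cvg ZM ZX).
Qed.

Context {FF : ProperFilter F}.

Lemma cvg_hnorm (u : T -> H) a : u @ F --> a -> hnorm (u t) @[t --> F] --> hnorm a.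
Proof.
move=> /hcvgP ua; apply/cvgrPdist_lt => e /ua; apply: filterS => t.
apply: le_lt_trans.
have := ler_hnormD (u t - a) a; rewrite subrK.
have := ler_hnormD (a - u t) (u t); rewrite subrK (hdistC a).
by move: (hnorm _) (hnorm _) (hnorm _) => p q d; rewrite ler_norml; lra.
Qed.

(** The points of convergence form a subspace containing every [b k], hence a dense one. The uniform
    bound carries the Cauchy property to all of [H], which is complete. *)
Lemma strong_limit (A : T -> bop H) (M : R) (b : nat -> H) :
  (forall t x, hnorm (A t x) <= M * hnorm x) -> total b ->
  (forall k, cvg (A t (b k) @[t --> F])) ->
  exists B : bop H, forall x, A t x @[t --> F] --> B x.
Proof.
move=> AM tb Ab; pose D := [set x | cvg (A t x @[t --> F])].
have DD x e : 0 < e -> exists2 y, D y & hnorm (x - y) < e.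
  apply: tb => //.
    apply/cvg_ex; exists 0; rewrite (_ : (fun _ => _) = cst 0); first exact: cvg_cst.
    by apply/funext => t; rewrite linear0.
  move=> c {}x y /cvg_ex[/= l xl] /cvg_ex[/= m ym]; apply/cvg_ex; exists (c *: l + m).
  rewrite (_ : (fun _ => _) = fun t => c *: A t x + A t y); last first.
    by apply/funext => t; rewrite linearP.
  by apply: hcvgD => //; exact: hcvgZ.
have M1 : 0 < `|M| + 1 by rewrite ltr_wpDl.
have Acvg x : cvg (A t x @[t --> F]).
  apply/cauchy_cvgP/cauchy_exP => e e0.
  have eE : e = (complex.Re e)%:C%C by rewrite RRe_real// gtr0_real.
  have {}e0 : 0 < complex.Re e by rewrite -ltcR -eE.
  have e1 : 0 < complex.Re e / 2 / (`|M| + 1) by rewrite !divr_gt0.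
  have [y /cvg_ex[/= l /hcvgP yl] xy] := DD x _ e1.
  (* The centre of the Cauchy ball is the limit at a nearby point [y] of convergence. *)
  exists l; have e2 : 0 < complex.Re e / 2 by rewrite divr_gt0.
  have := yl _ e2; apply: filterS => t ytl.
  rewrite -ball_normE /ball_/= eE hnormE ltcR -[l - _]opprB hnormN.
  rewrite (_ : A t x - l = A t (x - y) + (A t y - l)); last by rewrite linearB addrA subrK.
  rewrite (le_lt_trans (ler_hnormD _ _))// [ltRHS]splitr ler_ltD//.
  rewrite (le_trans (AM _ _))// (@le_trans _ _ ((`|M| + 1) * hnorm (x - y)))//.
    by rewrite ler_wpM2r ?hnorm_ge0// (le_trans (ler_norm _))// lerDl.
  by rewrite mulrC -ler_pdivlMr// ltW.
have /choice[B BE] : forall x, exists l : H, A t x @[t --> F] --> l.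
  by move=> x; have /cvg_ex := Acvg x.
have Bl : linear B.
  move=> c x y; apply: hcvg_unique (BE _) _.
  rewrite (_ : (fun _ => _) = fun t => c *: A t x + A t y); last first.
    by apply/funext => t; rewrite linearP.
  by apply: hcvgD; [apply: hcvgZ|]; exact: BE.
have BM x : hnorm (B x) <= M * hnorm x.
  have := cvg_hnorm (BE x) => Bx.
  rewrite -(norm_cvg_lim Bx); apply: limr_le; first exact: cvgP Bx.
  exact: nearW.
have [L LE] := bop_of_bounded Bl BM.
by exists L => x; rewrite LE.
Qed.

End StrongLimits.

(** * Gram-Schmidt in an ultrapower *)

Section AsymptoticGramSchmidt.
Variables (R : realType) (H : hilbertType R) (T : Type) (F : set_system T).
Implicit Types (x y z : T -> H) (b f : nat -> T -> H).

(** Besides properness, this is what Gram-Schmidt asks of [F]. It holds for ultrafilters, in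
    particular for the principal filter on one point, where the construction is the ordinary
    Gram-Schmidt process. *)
Definition has_bounded_limits :=
  forall (c : T -> R) (M : R), (forall t, `|c t| <= M) -> exists l : R, c @ F --> l.

Definition bdd x := exists M : R, forall t, hnorm (x t) <= M.

(* Linear span, modulo the families tending to 0 along F. *)
Inductive lspan (P : set (T -> H)) : set (T -> H) :=
| lspan_null z : z @ F --> (0 : H) -> lspan P z
| lspan_mem x : P x -> lspan P x
| lspan_comb (c : R[i]) x y z : lspan P x -> lspan P y ->
    (forall t, z t = c *: x t + y t) -> lspan P z.

Lemma lspan_sub (P Q : set (T -> H)) x : P `<=` lspan Q -> lspan P x -> lspan Q x.
Proof.
move=> PQ; elim=> [z z0|{}x /PQ//|c {}x y z _ Qx _ Qy zE].
  exact: lspan_null.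
exact: lspan_comb zE.
Qed.

Lemma bdd_comb (c : R[i]) x y : bdd x -> bdd y -> bdd (fun t => c *: x t + y t).
Proof.
move=> [M xM] [N yN]; exists (cabs c * M + N) => t.
by rewrite (le_trans (ler_hnormD _ _))// lerD// hnorm_scale ler_wpM2l ?cabs_ge0.
Qed.

Context {FF : ProperFilter F}.
Let filterF : Filter F := _.

Lemma ccvg_hdot_bdd x y : has_bounded_limits -> bdd x -> bdd y ->
  exists l, ccvg F (fun t => hdot (x t) (y t)) l.
Proof.
move=> Flim [M xM] [N yN].
have xyN t : cabs (hdot (x t) (y t)) <= `|M| * `|N|.
  rewrite (le_trans (cabs_hdot _ _))// ler_pM ?hnorm_ge0//.
    exact: le_trans (xM t) (ler_norm _).
  exact: le_trans (yN t) (ler_norm _).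
have [|a xa] := Flim (fun t => complex.Re (hdot (x t) (y t))) (`|M| * `|N|).
  by move=> t; apply: le_trans (xyN t); exact: ler_absRe_cabs.
have [|b xb] := Flim (fun t => complex.Im (hdot (x t) (y t))) (`|M| * `|N|).
  by move=> t; apply: le_trans (xyN t); exact: ler_absIm_cabs.
exists (Complex a b).
apply: (@ccvg_bound _ _ _ _ _ _ (fun t => `|complex.Re (hdot (x t) (y t)) - a| +
    `|complex.Im (hdot (x t) (y t)) - b|)).
  apply: nearW => t; case: (hdot _ _) => p q /=; exact: ler_cabs_ReIm.
rewrite -[0](addr0 (0 : R)); apply: cvgD.
  by apply/norm_cvg0P; rewrite -(subrr a); apply: cvgB => //; exact: cvg_cst.
by apply/norm_cvg0P; rewrite -(subrr b); apply: cvgB => //; exact: cvg_cst.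
Qed.

Definition prefix b n : set (T -> H) := [set x | exists2 i, (i < n)%N & x = b i].

(** For an ultrafilter, this is orthonormality of the first [n] classes in the ultrapower; it may
    fail at every single [t]. *)
Definition asym_orthonormal b n := forall i, (i < n)%N ->
  bdd (b i) /\ forall j, (j < n)%N ->
  ccvg F (fun t => hdot (b i t) (b j t)) (i == j)%:R.

Lemma asym_orthonormalW b n m : (m <= n)%N -> asym_orthonormal b n -> asym_orthonormal b m.
Proof.
move=> mn bn i im; have [bi bij] := bn i (leq_trans im mn).
by split=> // j jm; exact: bij (leq_trans jm mn).
Qed.

(** The coefficients are limits of inner products, constant in [t]: this keeps [y] in the span, at
    the price of orthogonality in the limit only. *)
Lemma asym_projection b n x : has_bounded_limits -> asym_orthonormal b n -> bdd x ->
  exists y, [/\ bdd y, lspan (prefix b n) y &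
    forall i, (i < n)%N -> ccvg F (fun t => hdot (x t - y t) (b i t)) 0].
Proof.
move=> Flim bn bx; elim: n bn => [_|n IHn bn].
  exists (fun=> 0); split=> //; first by exists 0 => t; rewrite hnorm0.
  by apply: lspan_null; exact: cvg_cst.
have [y [bddy yb yo]] := IHn (asym_orthonormalW (leqnSn n) bn).
have [bbn bnj] := bn n (ltnSn n).
have bxy : bdd (fun t => x t - y t).
  have := bdd_comb (-1) bddy bx; rewrite (_ : (fun t => _ + _) = fun t => x t - y t)//.
  by apply/funext => t; rewrite scaleN1r addrC.
have [c xc] := ccvg_hdot_bdd Flim bxy bbn.
exists (fun t => c *: b n t + y t); split.
- exact: bdd_comb.
- apply: (@lspan_comb _ c (b n) y) => //; first by apply: lspan_mem; exists n.
  by apply: lspan_sub yb => _ [i ni ->]; apply: lspan_mem; exists i => //; exact: ltnW.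
- move=> i; rewrite ltnS leq_eqVlt => /predU1P[->|ni].
    have h := ccvgB xc (ccvgMl c (bnj n (ltnSn n))).
    move: (h filterF filterF); rewrite eqxx mulr1 subrr => /ccvg_ext; apply=> t.
    by rewrite !hdotBl hdotDl hdotZl; ring.
  have h := ccvgB (yo i ni) (ccvgMl c (bnj i (ltnW ni))).
  move: (h filterF filterF); rewrite gtn_eqF// mulr0 subr0 => /ccvg_ext; apply=> t.
  by rewrite !hdotBl hdotDl hdotZl; ring.
Qed.

(** Take the least [m] with [f m] outside the current span, subtract the projection and normalise.
    Minimality gives the last clause: each step lengthens the initial segment of [f] known to be
    spanned, so every [f m] is eventually reached. *)
Lemma asym_orthonormal_extend b n f : has_bounded_limits -> (forall m, bdd (f m)) ->
  asym_orthonormal b n -> (forall i, (i < n)%N -> lspan (range f) (b i)) ->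
  (exists m, ~ lspan (prefix b n) (f m)) ->
  exists v, [/\ asym_orthonormal (fun i => if i == n then v else b i) n.+1,
    lspan (range f) v &
    forall k, (forall i, (i < k)%N -> lspan (prefix b n) (f i)) ->
      forall i, (i <= k)%N -> lspan (prefix (fun i => if i == n then v else b i) n.+1) (f i)].
Proof.
move=> Flim bf bn bsp exm.
pose bad := [pred m | `[< ~ lspan (prefix b n) (f m) >]].
have exbad : exists m, bad m by have [m fm] := exm; exists m; apply/asboolP.
have [m /asboolP fm mmin] := ex_minnP exbad.
have [y [bddy yb yo]] := asym_projection Flim bn (bf m).
have [M fM] := bf m; have [N yN] := bddy.
have rM t : hnorm (f m t - y t) <= M + N.
  by rewrite (le_trans (ler_hnormD _ _))// hnormN lerD.
have [s rs] : exists s : R, hnorm (f m t - y t) @[t --> F] --> s.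
  by apply: (Flim _ (M + N)) => t; rewrite ger0_norm ?hnorm_ge0.
have s_ge0 : 0 <= s.
  rewrite -(norm_cvg_lim rs); apply: limr_ge; first exact: cvgP rs.
  by apply: nearW => t; exact: hnorm_ge0.
(* A residual tending to 0 would put [f m] in the span of the prefix. *)
have s0 : s != 0.
  apply: contra_not_neq fm => s0; rewrite s0 in rs; move/hcvg0P in rs.
  by apply: (@lspan_comb _ 1 _ _ _ (lspan_null _ rs) yb) => t; rewrite scale1r subrK.
(* Dividing by the limit [s] of the norms, not by the norm at [t], keeps [v] in the span. *)
pose v t := (s^-1)%:C%C *: (f m t - y t).
have vi i : (i < n)%N -> ccvg F (fun t => hdot (v t) (b i t)) 0.
  move=> ni; have := ccvgMl (s^-1)%:C%C (yo i ni); rewrite mulr0.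
  by move=> /(_ filterF)/ccvg_ext; apply=> t; rewrite hdotZl.
have vv : ccvg F (fun t => hdot (v t) (v t)) 1.
  have : (s^-1 * hnorm (f m t - y t)) ^+ 2 @[t --> F] --> (1 : R).
    rewrite [X in _ --> X](_ : 1 = (s^-1 * s) ^+ 2); last by rewrite mulVf// expr1n.
    by rewrite expr2; apply: cvgM; apply: cvgM => //; exact: cvg_cst.
  move=> /ccvg_real/ccvg_ext; apply=> t.
  by rewrite hnorm2E hnorm_scale cabs_real ger0_norm// invr_ge0.
have bv : bdd v.
  exists (cabs (s^-1)%:C%C * (M + N)) => t.
  by rewrite hnorm_scale ler_wpM2l ?cabs_ge0.
exists v; split.
- move=> i; rewrite ltnS leq_eqVlt => /predU1P[->|ni].
    rewrite eqxx; split=> // j; rewrite ltnS leq_eqVlt => /predU1P[->|nj].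
      by rewrite !eqxx.
    by rewrite (ltn_eqF nj) (gtn_eqF nj); exact: vi.
  rewrite (ltn_eqF ni); have [bi bij] := bn i ni; split=> // j.
  rewrite ltnS leq_eqVlt => /predU1P[->|nj]; last by rewrite (ltn_eqF nj); exact: bij.
  rewrite eqxx (ltn_eqF ni); have := ccvgJ (vi i ni); rewrite conjc0.
  by move=> /(_ filterF)/ccvg_ext; apply=> t; rewrite -hdotC.
- apply: (@lspan_comb _ (s^-1)%:C%C (fun t => f m t - y t) (fun=> 0)).
  + apply: (@lspan_comb _ (-1) y (f m)); last by move=> t; rewrite scaleN1r addrC.
      by apply: lspan_sub yb => _ [i ni ->]; exact: bsp.
    by apply: lspan_mem; exists m.
  + by apply: lspan_null; exact: cvg_cst.
  + by move=> t; rewrite addr0.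
- have sub : prefix b n `<=` prefix (fun i => if i == n then v else b i) n.+1.
    by move=> _ [i ni ->]; exists i; [exact: ltnW|rewrite (ltn_eqF ni)].
  have subl x : lspan (prefix b n) x -> lspan (prefix (fun i => if i == n then v else b i) n.+1) x.
    by apply: lspan_sub => z /sub; exact: lspan_mem.
  (* As [f m] is not in the old span, [k <= m]. Indices below [m] are covered by minimality, and
     [f m] is [s v + y]. *)
  move=> k kf i ik; have km : (k <= m)%N by rewrite leqNgt; apply/negP => /kf.
  have [im|] := ltnP i m.
    apply: subl; apply: contrapT => /asboolP/mmin; by rewrite leqNgt im.
  move=> mi; have -> : i = m by apply/eqP; rewrite eqn_leq mi (leq_trans ik km).
  apply: (@lspan_comb _ s%:C%C v y) => //; last 1 first.
  + by move=> t; rewrite /v scalerA -rmorphM mulfV// scale1r subrK.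
  + by apply: lspan_mem; exists n => //; rewrite eqxx.
  + exact: subl.
Qed.

Lemma asym_gram_schmidt f : has_bounded_limits -> (forall m, bdd (f m)) ->
  (forall n b, asym_orthonormal b n -> exists m, ~ lspan (prefix b n) (f m)) ->
  exists b, [/\ forall n, asym_orthonormal b n, forall i, lspan (range f) (b i) &
    forall m, lspan (range b) (f m)].
Proof.
move=> Flim bf frank.
pose inv n b := asym_orthonormal b n /\ (forall i, (i < n)%N -> lspan (range f) (b i)).
have /choice[next nextP] : forall nb : nat * (nat -> T -> H), exists v, inv nb.1 nb.2 ->
    [/\ asym_orthonormal (fun i => if i == nb.1 then v else nb.2 i) nb.1.+1,
    lspan (range f) v &
    forall k, (forall i, (i < k)%N -> lspan (prefix nb.2 nb.1) (f i)) ->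
      forall i, (i <= k)%N ->
      lspan (prefix (fun i => if i == nb.1 then v else nb.2 i) nb.1.+1) (f i)].
  move=> [n b] /=; have [[bn bsp]|nb] := pselect (inv n b); last by exists (fun=> 0) => /nb.
  by have [v vP] := asym_orthonormal_extend Flim bf bn bsp (frank n b bn); exists v.
(* Stage [n.+1] changes only the entry of index [n], so the diagonal [b i = B i.+1 i] agrees with
   stage [n] below [n]. *)
pose B := fix B n := if n is m.+1 then
  (fun i => if i == m then next (m, B m) else B m i) else fun _ _ => 0 : H.
have Bstep n : B n.+1 = fun i => if i == n then next (n, B n) else B n i by [].
have Binv n : inv n (B n) /\ forall i, (i < n)%N -> lspan (prefix (B n) n) (f i).
  elim: n => [|n [In fn]]; first by split; [split|].
  have [h1 h2 h3] := nextP (n, B n) In; rewrite Bstep; split; last exact: h3.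
  split=> // i; rewrite ltnS leq_eqVlt => /predU1P[->|ni]; first by rewrite eqxx.
  by rewrite (ltn_eqF ni); exact: In.2.
pose b i := B i.+1 i.
have bB n i : (i < n)%N -> B n i = b i.
  elim: n => // n IHn; rewrite ltnS leq_eqVlt => /predU1P[->//|ni].
  by rewrite Bstep (ltn_eqF ni) IHn.
exists b; split.
- move=> n i ni; have [[on _] _] := Binv n; have [bi bij] := on i ni.
  by rewrite -(bB _ _ ni); split=> // j nj; rewrite -(bB _ _ nj); exact: bij.
- by move=> i; have [[_ sp] _] := Binv i.+1; exact: sp.
- move=> m; have [_ /(_ m (ltnSn m))] := Binv m.+1; apply: lspan_sub => _ [i im ->].
  by apply: lspan_mem; exists i => //; rewrite bB.
Qed.

End AsymptoticGramSchmidt.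

(** * Limits along ultrafilters, orthonormal bases and linear independence *)

Section BoundedLimits.
Variables (R : realType) (T : Type).

(** The image of [F] under [c] is an ultrafilter containing the compact interval from [-M] to
    [M]. *)
Lemma ultra_has_bounded_limits (F : set_system T) : UltraFilter F ->
  has_bounded_limits R F.
Proof.
move=> FU c M cM.
have : compact `[- M, M]%classic by exact: segment_compact.
rewrite compact_ultra => /(_ (c @ F)).
have cFU : UltraFilter (c @ F).
  split=> [|G PG cFG]; first exact: fmap_proper_filter.
  apply/seteqP; split=> // A GA.
  have [|FA] := in_ultra_setVsetC (c @^-1` A) FU; first by [].
  have : G (A `&` ~` A) by apply: filterI => //; exact: cFG.
  by rewrite setICr => /filter_not_empty.
have cFM : (c @ F) `[- M, M]%classic.
  by apply: (@filterE _ F) => t; rewrite /= in_itv /= -ler_norml.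
by move=> /(_ cFU cFM)[l [_ cl]]; exists l.
Qed.

End BoundedLimits.

Section Bases.
Variables (R : realType) (H : hilbertType R).

Lemma lspan_prefixP (T : Type) (F : set_system T) {FF : Filter F}
  (b : nat -> T -> H) n x : lspan F (prefix b n) x ->
  exists c : 'I_n -> R[i], (fun t => x t - \sum_(i < n) c i *: b i t) @ F --> (0 : H).
Proof.
elim=> [z z0|_ [i ni ->]|a {}x y z _ [c xc] _ [d yd] zE].
- exists (fun=> 0); rewrite (_ : (fun t => _) = z)//; apply/funext => t.
  by rewrite big1 ?subr0// => i _; rewrite scale0r.
- exists (fun j => (j == Ordinal ni)%:R); rewrite (_ : (fun t => _) = cst 0).
    exact: cvg_cst.
  apply/funext => t; rewrite (bigD1 (Ordinal ni))//= eqxx scale1r big1 ?addr0 ?subrr//.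
  by move=> j /negPf ->; rewrite scale0r.
- exists (fun i => a * c i + d i).
  rewrite (_ : (fun t => _) = fun t => a *: (x t - \sum_(i < n) c i *: b i t) +
    (y t - \sum_(i < n) d i *: b i t)); last first.
    apply/funext => t; rewrite zE scalerBr addrACA -opprD; congr (_ - _).
    rewrite scaler_sumr -big_split; apply: eq_bigr => i _ /=.
    by rewrite scalerDl scalerA.
  by have := hcvgD (hcvgZ (c := a) xc) yd; rewrite scaler0 addr0; exact.
Qed.

(** On a one-point index set a null family is zero, so [lspan] is the ordinary span. *)
Lemma lspan_unit (P : set (unit -> H)) (D : set H) x : D 0 ->
  (forall (c : R[i]) x y, D x -> D y -> D (c *: x + y)) ->
  (forall y, P y -> D (y tt)) -> lspan (principal_filter tt) P x -> D (x tt).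
Proof.
move=> D0 DD PD; elim=> [z z0|y /PD//|c {}x y z _ Dx _ Dy ->]; last exact: DD.
have FF : ProperFilter (principal_filter tt) by exact: principal_filter_proper.
rewrite (_ : z tt = 0)//; apply: hcvg_unique z0.
by rewrite (_ : z = cst (z tt)); [exact: cvg_cst|apply/funext; case].
Qed.

Lemma dense_near (D : set H) x (e : R) : dense D -> 0 < e ->
  exists2 y, D y & hnorm (x - y) < e.
Proof.
move=> dD e0.
have [||y [xy Dy]] := dD (interior (ball x e%:C%C)).
- exists x; apply: nbhsx_ballx; by rewrite ltcR.
- exact: open_interior.
exists y => //; have := interior_subset xy.
by rewrite -ball_normE /ball_/= hnormE ltcR.
Qed.

(** Gram-Schmidt is run on a dense sequence over a one-point index set. It never stops: otherwise
    some [x] outside a finite span would have a nonzero residual orthogonal to a dense set. *)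
Lemma orthonormal_basis : infinite_dimensional H -> separable_space H ->
  exists b : nat -> H, (forall i j, hdot (b i) (b j) = (i == j)%:R) /\ total b.
Proof.
move=> Hinf [D /countable_injP[p pD] dD].
(* At indices outside the image of [D] under [p] the value of [d] is arbitrary; it only matters that
   [d] runs through all of [D]. *)
have /choice[d dP] : forall n, exists x, (exists2 y, D y & p y = n) -> D x /\ p x = n.
  move=> n; have [[y Dy yn]|ny] := pselect (exists2 y, D y & p y = n); last by exists 0 => /ny.
  by exists y.
have Dd x : D x -> exists n, d n = x.
  move=> Dx; exists (p x); have [|Dpx px] := dP (p x); first by exists x.
  by apply: pD; rewrite ?inE.
pose F := principal_filter tt.
have FF : ProperFilter F by exact: principal_filter_proper.
have Flim : has_bounded_limits R F.
  move=> c M _; exists (c tt).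
  by rewrite (_ : c = cst (c tt)); [exact: cvg_cst|apply/funext; case].
have Fc (c : unit -> R[i]) l : ccvg F c l -> c tt = l.
  by apply: ccvg_unique; apply: (ccvg_ext (ccvg_cst (c tt))); case.
have bdu (x : unit -> H) : bdd x by exists (hnorm (x tt)); case.
have [|n b bn|b [bo bd db]] := @asym_gram_schmidt R H unit F FF (fun m _ => d m) Flim.
- by move=> m; exact: bdu.
- apply: contrapT => /forallNP nd.
  have {}nd m : lspan F (prefix b n) (fun=> d m) by apply: contrapT; exact: nd.
  have [x xP] := Hinf n (fun i => b i tt).
  have [y [_ yb yo]] := asym_projection Flim bn (bdu (fun=> x)).
  pose r := x - y tt.
  have rb i : (i < n)%N -> hdot r (b i tt) = 0 by move=> ni; exact: Fc (yo i ni).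
  have rd m : hdot r (d m) = 0.
    apply: (@lspan_unit _ [set z | hdot r z = 0] _ _ _ _ (nd m)).
    + by rewrite /= linear0r.
    + by move=> c u v /= ru rv; rewrite hdotDr hdotZr ru rv mulr0 addr0.
    + by move=> _ [i ni ->] /=; exact: rb.
  have r0 : r = 0.
    apply: hnorm0_eq0; apply/le_anti; rewrite hnorm_ge0 andbT leNgt; apply/negP => r0.
    (* [|r|^2 = <r, r - d m> <= |r| |r - d m|] contradicts [|r - d m| < |r|]. *)
    have [_ /Dd[m <-]] := dense_near r dD r0; rewrite ltNge => /negP; apply.
    rewrite -(ler_pM2l r0) -expr2 -[leLHS]ReC -hnorm2E -[X in complex.Re X]subr0 -(rd m).
    by rewrite -hdotBr (le_trans (Re_le_cabs _))// cabs_hdot.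
  have [c yc] := lspan_prefixP yb.
  have xy : x = y tt by apply/eqP; rewrite -subr_eq0 -/r r0.
  move: (xP c); rewrite xy => /negP; apply; rewrite -subr_eq0; apply/eqP.
  apply: hcvg_unique yc.
  by apply: cvg_near_cst; apply: nearW; case.
exists (fun k => b k tt); split.
- move=> i j; have [_ h] := bo (maxn i j).+1 i (leq_maxl i j).
  exact: Fc (h j (leq_maxr i j)).
- move=> D' D0 DD Db x e e0; have [y /Dd[m <-] xy] := dense_near x dD e0.
  exists (d m) => //; apply: (lspan_unit D0 DD _ (db m)).
  by move=> _ [k _ <-].
Qed.

(** Otherwise the coefficients of [n + 1] of these families form a matrix with a nonzero left kernel
    vector [a]. Then [V_t] applied to the combination of the [e k] by [a] tends to 0; its norm being
    constant in [t], the combination is 0, against orthonormality. So Gram-Schmidt over these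
    families never stops. *)
Lemma isom_images_independent (T : Type) (F : set_system T) {FF : ProperFilter F}
  (V : T -> isom H) (e : nat -> H) (b : nat -> T -> H) n :
  (forall i j, hdot (e i) (e j) = (i == j)%:R) ->
  exists k, ~ lspan F (prefix b n) (fun t => V t (e k)).
Proof.
move=> eo; apply: contrapT => /forallNP nd.
have {nd} /choice[c cP] : forall k, exists c : 'I_n -> R[i],
    (fun t => V t (e k) - \sum_(i < n) c i *: b i t) @ F --> (0 : H).
  by move=> k; apply: lspan_prefixP; apply: contrapT; exact: nd.
pose M : 'M[R[i]]_(n.+1, n) := \matrix_(k, i) c k i.
have : kermx M != 0.
  by rewrite -mxrank_eq0 mxrank_ker subn_eq0 -ltnNge ltnS rank_leq_col.
move=> /rowV0Pn[a /sub_kermxP aM]; apply/negP; rewrite negbK; apply/eqP.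
pose s := \sum_(k < n.+1) a 0 k *: e k.
have s0 : s = 0.
  have : (fun t => \sum_(k < n.+1) a 0 k *: (V t (e k) - \sum_(i < n) c k i *: b i t))
      @ F --> (0 : H).
    rewrite [X in _ --> X](_ : _ = \sum_(k < n.+1) a 0 k *: (0 : H)); last first.
      by rewrite big1// => k _; rewrite scaler0.
    apply: (@hcvg_sum R H T F _ _ _ (fun k t => a 0 k *: (V t (e k) - \sum_(i < n) c k i *: b i t))
      (fun k => a 0 k *: 0)).
    by move=> k; exact: hcvgZ.
  rewrite (_ : (fun t => _) = fun t => V t s) => [Vs|]; last first.
    apply/funext => t; under eq_bigr do rewrite scalerBr; rewrite sumrB.
    rewrite [X in _ - X](_ : _ = 0) ?subr0.
      by rewrite /s linear_sum; apply: eq_bigr => k _; rewrite linearZ.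
    under eq_bigr do rewrite scaler_sumr; rewrite exchange_big/= big1// => i _.
    under eq_bigr do rewrite scalerA; rewrite -scaler_suml.
    have := congr1 (fun A : 'M_(_, _) => A 0 i) aM; rewrite !mxE => aMi.
    rewrite (_ : \sum_(k < _) _ = 0) ?scale0r// -[RHS]aMi.
    by apply: eq_bigr => k _; rewrite mxE.
  apply: hnorm0_eq0; have /cvg_hnorm := Vs; rewrite hnorm0.
  rewrite (_ : (fun t => _) = cst (hnorm s)) => [h|].
    have h' : cst (hnorm s) @ F --> hnorm s by exact: cvg_cst.
    exact: (norm_cvg_unique h' h).
  by apply/funext => t; rewrite hnorm_isom.
apply/rowP => k; rewrite mxE; have := congr1 (hdot^~ (e k)) s0.
rewrite /s linear0l => <-.
rewrite (big_morph (hdot^~ (e k)) (fun x y => hdotDl x y _) (hdot0l _)) (bigD1 k)//=.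
rewrite hdotZl eo eqxx mulr1 big1 ?addr0// => i ik.
by rewrite hdotZl eo -(inj_eq val_inj) in ik *; rewrite (negPf ik) mulr0.
Qed.

End Bases.

(** * Alignment by unitaries *)

Section Alignment.
Variables (R : realType) (H : hilbertType R) (e : nat -> H).
Hypothesis e_orthonormal : forall i j, hdot (e i) (e j) = (i == j)%:R.

(** Follow [U] by the reflection taking [U (e n)] to the normalised residual. Both vectors are
    orthogonal to the earlier [U (e k)], which the reflection therefore fixes. *)
Lemma align_step (U : isom H) n x : unitary U ->
  let r := x - \sum_(k < n) hdot x (U (e k)) *: U (e k) in r != 0 ->
  exists U' : isom H, [/\ unitary U', forall k, (k < n)%N -> U' (e k) = U (e k) &
    U' (e n) = (hnorm r)^-1%:C%C *: r].
Proof.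
move=> uU r r0.
have nr0 : hnorm r != 0 by apply: contra_neq r0; exact: hnorm0_eq0.
have eo k : hdot (U (e k)) (U (e n)) = (k == n)%:R by rewrite hdot_isom.
have ro k : (k < n)%N -> hdot r (U (e k)) = 0.
  move=> kn; rewrite /r hdotBl.
  rewrite (big_morph (hdot^~ (U (e k))) (fun x y => hdotDl x y _) (hdot0l _)).
  rewrite (bigD1 (Ordinal kn))//= hdotZl hdot_isom e_orthonormal eqxx mulr1 big1 ?addr0 ?subrr//.
  move=> i ik; rewrite hdotZl hdot_isom e_orthonormal.
  by rewrite -(inj_eq val_inj) /= in ik; rewrite (negPf ik) mulr0.
have [||Q [uQ Qb Qx]] := @reflection_unitary R H (U (e n)) ((hnorm r)^-1%:C%C *: r).
- by apply: hdot_self_eq1; rewrite eo eqxx.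
- by rewrite hnormZr ?invr_ge0 ?hnorm_ge0// mulVf.
have [W WE] := isom_comp Q U; exists W; split.
- exact: unitary_isom_comp WE uQ uU.
- move=> k kn; rewrite WE /= Qx// ?eo ?(ltn_eqF kn)//.
  by rewrite hdotZr hdotC ro// conjc0 mulr0.
- by rewrite WE.
Qed.

Lemma align_prefix (T : Type) (F : set_system T) {FF : ProperFilter F} (b : nat -> T -> H) n :
  asym_orthonormal F b n ->
  exists U : T -> isom H, (forall t, unitary (U t)) /\
    forall k, (k < n)%N -> (fun t => U t (e k) - b k t) @ F --> (0 : H).
Proof.
have FF' : Filter F by case: FF.
elim: n => [_|n IHn bn].
  have [V VE] := isom_id H; exists (fun=> V); split=> // _ y.
  by rewrite VE -[RHS](isomK V) VE.
have [U [uU Ub]] := IHn (asym_orthonormalW (leqnSn n) bn).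
have [[M bM] bnj] := bn n (ltnSn n).
(* [b n t] is corrected to be exactly orthogonal to the vectors already aligned; the correction
   tends to 0, so [|r t|] tends to 1. *)
pose r t := b n t - \sum_(k < n) hdot (b n t) (U t (e k)) *: U t (e k).
have hU k t : hnorm (U t (e k)) = 1.
  by rewrite hnorm_isom; apply: hdot_self_eq1; rewrite e_orthonormal eqxx.
have sum0 : (fun t => \sum_(k < n) hdot (b n t) (U t (e k)) *: U t (e k)) @ F --> (0 : H).
  have hk (k : 'I_n) : (fun t => hdot (b n t) (U t (e k)) *: U t (e k)) @ F --> (0 : H).
    have h : ccvg F (fun t => hdot (b n t) (U t (e k))) 0.
      have h1 : ccvg F (fun t => hdot (U t (e k) - b k t) (b n t)) 0.
        exact: ccvg0_hdot (Ub k (ltn_ord k)) (nearW _ bM).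
      have := ccvgD (ccvgJ h1) (bnj k (ltn_trans (ltn_ord k) (ltnSn n))).
      move=> /(_ FF' FF'); rewrite conjc0 add0r gtn_eqF// => /ccvg_ext; apply => t.
      by rewrite -hdotC hdotBr subrK.
    have hM t : hnorm (U t (e k)) <= 1 by rewrite hU.
    have := hcvgZr h hM.
    rewrite (_ : (fun t => _) = (fun t => hdot (b n t) (U t (e k)) *: U t (e k))).
      exact.
    by apply/funext => t; rewrite scale0r subr0.
  have := @hcvg_sum R H T F FF' _ (index_enum 'I_n) _ _ hk.
  by rewrite [X in _ --> X]big1.
have rb0 : (fun t => r t - b n t) @ F --> (0 : H).
  have := hcvgZ (c := -1) sum0; rewrite scaler0 => /(_ FF').
  rewrite (_ : (fun t => _) = (fun t => r t - b n t)); first exact.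
  by apply/funext => t; rewrite scaleN1r /r addrC addKr.
have rM : \forall t \near F, hnorm (r t) <= hnorm (0 : H) + 1 + M.
  apply: filterS (hcvg_bounded rb0) => t rt.
  by rewrite -[r t](subrK (b n t)) (le_trans (ler_hnormD _ _))// lerD.
have rr : ccvg F (fun t => hdot (r t) (r t)) 1.
  have h1 : ccvg F (fun t => hdot (r t - b n t) (r t)) 0 by exact: ccvg0_hdot rb0 rM.
  have h2 : ccvg F (fun t => hdot (r t - b n t) (b n t)) 0.
    exact: ccvg0_hdot rb0 (nearW _ bM).
  have := ccvgD (ccvgD h1 (ccvgJ h2)) (bnj n (ltnSn n)).
  rewrite eqxx conjc0 !add0r => /(_ FF' FF' FF')/ccvg_ext; apply => t.
  by rewrite -hdotC hdotBl !hdotBr; ring.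
have /choice[U' U'E] : forall t, exists U' : isom H, [/\ unitary U',
    forall k, (k < n)%N -> U' (e k) = U t (e k) &
    r t != 0 -> U' (e n) = (hnorm (r t))^-1%:C%C *: r t].
  (* Where [r t = 0], which eventually does not happen along [F], [U t] is kept. *)
  move=> t; have [r0|r0] := eqVneq (r t) 0; first by exists (U t); split.
  by have [U' [h1 h2 h3]] := align_step (uU t) r0; exists U'; split.
exists U'; split=> [t|k]; first by have [] := U'E t.
rewrite ltnS leq_eqVlt => /predU1P[->|kn]; last first.
  rewrite (_ : (fun t => _) = fun t => U t (e k) - b k t); first exact: Ub.
  by apply/funext => t; have [_ Uk _] := U'E t; rewrite Uk.
rewrite (_ : (fun t => _) = fun t => (U' t (e n) - r t) + (r t - b n t)); last first.
  by apply/funext => t; rewrite addrA subrK.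
suff : (fun t => U' t (e n) - r t) @ F --> (0 : H).
  by move=> /hcvgD/(_ rb0); rewrite addr0; exact.
apply: (hcvg0_bound _ rr).
have : \forall t \near F, cabs (hdot (r t) (r t) - 1) < 1.
  have /cvgrPdist_lt/(_ _ ltr01) := rr; apply: filterS => t.
  by rewrite sub0r normrN ger0_norm ?cabs_ge0.
apply: filterS => t rt.
have r0 : r t != 0.
  by apply: contraTneq rt => ->; rewrite linear0r sub0r cabsN cabs1 ltxx.
have [_ _ /(_ r0) ->] := U'E t.
have nr0 : hnorm (r t) != 0 by apply: contra_neq r0; exact: hnorm0_eq0.
rewrite (_ : _ - r t = ((hnorm (r t))^-1%:C%C - 1) *: r t); last by rewrite scalerBl scale1r.
rewrite hnorm_scale -rmorphB cabs_real hnorm2E -rmorphB cabs_real.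
(* As [|r| + 1 >= 1], this factorisation bounds the normalisation error by [||r|^2 - 1|], which
   tends to 0. *)
rewrite (_ : hnorm (r t) ^+ 2 - 1 = - (((hnorm (r t))^-1 - 1) * hnorm (r t) * (hnorm (r t) + 1))).
  rewrite normrN [leRHS]normrM normrM (ger0_norm (hnorm_ge0 (r t))).
  by rewrite ler_peMr ?mulr_ge0 ?hnorm_ge0// ger0_norm ?lerDr ?addr_ge0 ?hnorm_ge0.
by field.
Qed.

(* Aligning longer and longer prefixes is only possible for t far enough along
   F, hence the iterated filter on pairs (n, t). *)
Definition iterated_filter (T : Type) (F : set_system T) : set_system (nat * T) :=
  fun A => \forall n \near \oo, \forall t \near F, A (n, t).

Lemma iterated_filter_proper (T : Type) (F : set_system T) :
  ProperFilter F -> ProperFilter (iterated_filter F).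
Proof.
move=> FF; split=> [h|].
  by have [n /filter_not_empty] := @filter_ex _ \oo _ _ h.
split.
- by apply: nearW => n; exact: filterT.
- by move=> A B; rewrite /iterated_filter => FA FB; apply: filterS2 FA FB => n; exact: filterI.
- by move=> A B AB; rewrite /iterated_filter; apply: filterS => n; apply: filterS => t; exact: AB.
Qed.

Lemma align (T : Type) (F : set_system T) (b : nat -> T -> H) :
  ProperFilter F -> (forall n, asym_orthonormal F b n) ->
  exists U : nat * T -> isom H, (forall p, unitary (U p)) /\
    forall k, (fun p => U p (e k) - b k p.2) @ iterated_filter F --> (0 : H).
Proof.
move=> FF bo; have FF' := iterated_filter_proper FF.
have /choice[U UE] : forall n, exists U : T -> isom H, (forall t, unitary (U t)) /\
    forall k, (k < n)%N -> (fun t => U t (e k) - b k t) @ F --> (0 : H).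
  by move=> n; exact: align_prefix (bo n).
exists (fun p => U p.1 p.2); split=> [p|k]; first by have [uU _] := UE p.1.
apply/hcvgP => d d0; exists k.+1 => // n /= kn.
by have [_ /(_ k kn)/hcvgP] := UE n; apply.
Qed.

Lemma iterated_filter_snd (T : Type) (F : set_system T) (A : set T) :
  F A -> iterated_filter F (fun p => A p.2).
Proof. by move=> FA; exact: nearW. Qed.

End Alignment.

(** * The limit tuple and the limit isometry *)

Section LimitPair.
Variables (R : realType) (H : hilbertType R) (g : nat).

Lemma hnorm_word_le (X : satuple H g) (M : R) : 0 <= M ->
  (forall j h, hnorm (X j h) <= M * hnorm h) ->
  forall m h, hnorm (word_fun X m h) <= M ^+ size m * hnorm h.
Proof.
move=> M0 XM m h; elim: m => [|j m IHm] /=; first by rewrite expr0 mul1r.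
by rewrite (le_trans (XM _ _))// exprS -mulrA ler_wpM2l.
Qed.

(** As [U_p^* b_k] tends to [e_k], [U_p^* x] converges for every [x] in the common span of the [f m]
    and the [b k]. This span is stable under the [X_j], so the conjugated operators converge at each
    [e_k], and totality gives the rest. Unitarity of [U_p] makes [S] isometric. *)
Lemma limit_pair (Hinf : infinite_dimensional H) (Hsep : separable_space H)
    (T : Type) (F : set_system T) (X : T -> satuple H g) (V : T -> isom H) (M : R) :
  UltraFilter F -> 0 <= M -> (forall t j h, hnorm (X t j h) <= M * hnorm h) ->
  exists (U : nat * T -> isom H) (Z : satuple H g) (S : isom H),
  [/\ forall p, unitary (U p),
    forall j h, tcompress (U p) (X p.2) j h @[p --> iterated_filter F] --> Z j h &
    forall h, adj (U p) (V p.2 h) @[p --> iterated_filter F] --> S h].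
Proof.
move=> FU M0 XM; have FF : ProperFilter F by exact: ultra_proper.
have [e [eo et]] := orthonormal_basis Hinf Hsep.
(* Enumeration of all pairs of a word and a basis index; numbers coding no pair give the zero
   family. *)
pose f m t : H := if unpickle m is Some wk then
  word_fun (X t) (wk : seq 'I_g * nat).1 (V t (e wk.2)) else 0.
have fE w k : f (pickle (w, k)) = fun t => word_fun (X t) w (V t (e k)).
  by rewrite /f pickleK.
have bf m : bdd (f m).
  rewrite /f; case: (unpickle m) => [[w k]|]; last by exists 0 => t; rewrite hnorm0.
  exists (M ^+ size w * hnorm (e k)) => t.
  by rewrite -(hnorm_isom (V t) (e k)); apply: hnorm_word_le => //; exact: XM.
have [|b [bo bsp fsp]] := asym_gram_schmidt (ultra_has_bounded_limits FU) bf.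
  move=> n b _; have [k kP] := @isom_images_independent R H T F FF V e b n eo.
  by exists (pickle ([::] : seq 'I_g, k)); rewrite fE.
have [U [uU Ub]] := align eo FF bo.
pose F' := iterated_filter F; have FF' : ProperFilter F' by exact: iterated_filter_proper.
have lift (u : T -> H) (l : H) : u @ F --> l -> u p.2 @[p --> F'] --> l.
  move=> /hcvgP ul; apply/hcvgP => d /ul; exact: iterated_filter_snd.
have null (u : T -> H) : u @ F --> (0 : H) -> adj (U p) (u p.2) @[p --> F'] --> (0 : H).
  move=> /lift u0; apply: (@hcvg0_le _ _ _ _ _ 1 _ _ u0); apply: nearW => p.
  by rewrite mul1r hnorm_adj_isom.
have Ub' k : adj (U p) (b k p.2) @[p --> F'] --> e k.
  apply/hcvg_subP; apply: (@hcvg0_le _ _ _ _ _ 1 _ _ (Ub k)); apply: nearW => p.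
  rewrite mul1r hdistC -{1}(isomK (U p) (e k)) -linearB; exact: hnorm_adj_isom.
have comb c (x y z : T -> H) (l m : H) : (forall t, z t = c *: x t + y t) ->
    adj (U p) (x p.2) @[p --> F'] --> l -> adj (U p) (y p.2) @[p --> F'] --> m ->
    adj (U p) (z p.2) @[p --> F'] --> c *: l + m.
  move=> zE xl ym; rewrite (_ : (fun p => _) = fun p => c *: adj (U p) (x p.2) + adj (U p) (y p.2)).
    by apply: hcvgD => //; exact: hcvgZ.
  by apply/funext => p; rewrite zE linearP.
have /choice[y yP] m : exists y : H, adj (U p) (f m p.2) @[p --> F'] --> y.
  elim: (fsp m) => [z z0|_ [k _ <-]|c x x' z _ [l xl] _ [l' xl'] zE].
  - by exists 0; exact: null.
  - by exists (e k); exact: Ub'.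
  - by exists (c *: l + l'); exact: comb zE _ _.
pose Z p := tcompress (U p) (X p.2).
have ZM p j h : hnorm (Z p j h) <= M * hnorm h by apply: hnorm_compress_le; exact: XM.
have Zcvg0 (w : nat * T -> H) j : w @ F' --> (0 : H) -> Z p j (w p) @[p --> F'] --> (0 : H).
  by move=> w0; apply: (@hcvg0_le _ _ _ _ _ M _ _ w0); exact: nearW.
have Zy j m : exists l : H, Z p j (y m) @[p --> F'] --> l.
  (* Applying [X_j] prepends the letter [j] to the word. *)
  have [m' m'E] : exists m', forall t, X t j (f m t) = f m' t.
    rewrite /f; case um: (unpickle m) => [[w k]|]; last by exists m => t; rewrite um linear0.
    by exists (pickle (j :: w, k)) => t; rewrite pickleK.
  exists (y m'); have /hcvg_subP ym0 := yP m; have h := Zcvg0 _ j ym0.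
  have := hcvgB (yP m') h; rewrite subr0 => /(_ _).
  rewrite (_ : (fun p => _) = fun p => Z p j (y m)); first exact.
  (* [Z_p y_m] is [U_p^* f_m' - Z_p (U_p^* f_m - y_m)], whose last term tends to 0. *)
  apply/funext => p; rewrite bopB opprB addrCA /Z !tcompressE uU m'E subrr.
  by rewrite addr0.
have Zsp x : lspan F (range f) x -> exists l : H,
    adj (U p) (x p.2) @[p --> F'] --> l /\ forall j, exists l' : H, Z p j l @[p --> F'] --> l'.
  elim=> [z z0|_ [m _ <-]|c {}x x' z _ [l [xl lZ]] _ [l' [xl' lZ']] zE].
  - exists 0; split; first exact: null.
    by move=> j; exists 0; apply: Zcvg0; exact: cvg_cst.
  - by exists (y m); split => // j; exact: Zy.
  - exists (c *: l + l'); split; first exact: comb zE _ _.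
    move=> j; have [a la] := lZ j; have [a' la'] := lZ' j; exists (c *: a + a').
    rewrite (_ : (fun p => _) = fun p => c *: Z p j l + Z p j l'); last first.
      by apply/funext => p; rewrite linearP.
    by apply: hcvgD => //; exact: hcvgZ.
have Ze j k : cvg (Z p j (e k) @[p --> F']).
  (* For the family [b k] the limit [l] is [e k]. *)
  have [l [bl lZ]] := Zsp _ (bsp k).
  by rewrite (hcvg_unique (Ub' k) bl); apply/cvg_ex; exact: lZ.
have /choice[B BE] j : exists B : bop H, forall h, Z p j h @[p --> F'] --> B h.
  by apply: (strong_limit _ et (Ze j)) => p h; exact: ZM.
have Badj j : adj (B j) = B j.
  apply: adj_unique => x x'; apply: (@ccvg_unique R _ F').
    exact: ccvg_hdot (BE j x) (cvg_cst x').
  apply: ccvg_ext (ccvg_hdot (cvg_cst x) (BE j x')) _ => p.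
  exact/esym/saop_hdot.
have [S SE] : exists S : bop H, forall h, adj (U p) (V p.2 h) @[p --> F'] --> S h.
  apply: (@strong_limit R H _ F' FF' (fun p => bop_comp (adj (U p)) (V p.2)) 1 e _ et).
    move=> p h; rewrite mul1r; apply: le_trans (hnorm_adj_isom (U p) _) _.
    by rewrite hnorm_isom.
  move=> k; apply/cvg_ex; exists (y (pickle ([::] : seq 'I_g, k))).
  by have := yP (pickle ([::] : seq 'I_g, k)); rewrite fE.
have [h|S' S'E] := @isom_of_hnorm R H S.
  apply: (norm_cvg_unique (cvg_hnorm (SE h))).
  rewrite (_ : (fun p => _) = cst (hnorm h)); first exact: cvg_cst.
  by apply/funext => p; rewrite hnorm_adj_unitary// hnorm_isom.
exists U, (fun j => SAOp (Badj j)), S'; split => // h.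
by rewrite S'E.
Qed.

End LimitPair.

(** * Closedness of the hulls *)

Section OperatorNorm.
Variables (R : realType) (H : hilbertType R).

Lemma hnorm_le_opnorm (A : bop H) h : hnorm (A h) <= opnorm A * hnorm h.
Proof.
have [->|h0] := eqVneq h 0; first by rewrite linear0 hnorm0 mulr0.
have nh0 : 0 < hnorm h.
  by rewrite lt_def hnorm_ge0 andbT; apply: contra_neq h0; exact: hnorm0_eq0.
have [M M0 AM] := bop_bounded A.
rewrite -ler_pdivrMr// mulrC -hnormZr ?invr_ge0 ?hnorm_ge0// -linearZ.
apply: ub_le_sup.
  exists M => _ [x x1 <-]; rewrite (le_trans (AM x))// ler_piMr//.
  by rewrite -lecR -hnormE.
exists ((hnorm h)^-1%:C%C *: h) => //=.
by rewrite hnormE hnormZr ?invr_ge0 ?hnorm_ge0// mulVf ?gt_eqF.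
Qed.

Lemma tbounded_hnorm_le g (K : set (satuple H g)) : tbounded K ->
  exists2 M : R, 0 <= M & forall X j h, K X -> hnorm (X j h) <= M * hnorm h.
Proof.
move=> [M KM]; exists `|M| => // X j h KX.
apply: le_trans (hnorm_le_opnorm (X j) h) _; rewrite ler_wpM2r ?hnorm_ge0//.
apply: (@le_trans _ _ (tnorm X)); first exact: le_bigmax.
by rewrite (le_trans _ (ler_norm _))//; apply: KM; exists X.
Qed.

End OperatorNorm.

Section Closedness.
Variables (R : realType) (H : hilbertType R).

Lemma closed_filterP g (C : set (satuple H g)) :
  (forall (F : set_system (satuple H g)) Y, ProperFilter F -> F C -> F --> Y -> C Y) ->
  closed C.
Proof.
move=> CP Y; rewrite closureEcvg => -[F FF [FY CF]].
by apply: (CP F) => //; exact: CF.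
Qed.

Variables (g r : nat) (Gamma : 'I_r -> sym_fpoly R g) (K : set (satuple H g)).
Hypothesis Kfree : free_set K.

(** Gamma commutes with unitary similarity and direct sums, so its image inherits both closure
    properties from [K]. *)
Lemma hull_Geval_imageE : operator_convex_hull (Geval Gamma @` K) =
  [set Y | exists2 X, K X & exists V : isom H, Y = tcompress V (Geval Gamma X)].
Proof.
rewrite operator_convex_hullE.
- apply/seteqP; split=> Y.
    by move=> [_ [X KX <-] YE]; exists X.
  by move=> [X KX YE]; exists (Geval Gamma X) => //; exists X.
- move=> _ U [X KX <-] uU; exists (tcompress U X); last exact: Geval_compress.
  exact: Kfree.1.
- move=> n X W n0 KX uW.
  have /choice[X' X'E] i : exists X', K X' /\ Geval Gamma X' = X i.
    by have [X' KX' <-] := KX i; exists X'.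
  have [Z ZE] := direct_sum_exists uW X'.
  exists (Geval Gamma Z).
    by exists Z => //; apply: (Kfree.2 n X' W) => // i; exact: (X'E i).1.
  have := Geval_direct_sum Gamma ZE; congr is_direct_sum.
  by apply/funext => i; exact: (X'E i).2.
Qed.

Hypothesis Hinf : infinite_dimensional H.
Hypothesis Hsep : separable_space H.
Hypothesis Kbounded : tbounded K.
Hypothesis Kclosed : closed K.

Lemma closed_hull_Geval_image : closed (operator_convex_hull (Geval Gamma @` K)).
Proof.
have [M M0 KM] := tbounded_hnorm_le Kbounded.
rewrite hull_Geval_imageE; set C := [set Y | _].
apply: closed_filterP => G Y GG GC GY.
have [F [FU GF]] := ultraFilterLemma GG.
have FF : ProperFilter F by exact: ultra_proper.
have FY : F --> Y by exact: cvg_trans GY.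
have [_ [X0 KX0 [V0 _]]] := filter_ex GC.
(* A fixed pair serves as default where [t] is not in [C], so the first component lies in [K], and
   is bounded by [M], for every [t]. *)
have /choice[P PE] t : exists P : satuple H g * isom H,
    K P.1 /\ (C t -> t = tcompress P.2 (Geval Gamma P.1)).
  have [[X KX [V tE]]|nC] := pselect (C t); first by exists (X, V).
  by exists (X0, V0).
have [|U [Z [S [uU UZ US]]]] := @limit_pair R H g Hinf Hsep _ F (fun t => (P t).1)
  (fun t => (P t).2) M FU M0.
  by move=> t j h; apply: KM; exact: (PE t).1.
have FF' := iterated_filter_proper FF.
have KZ : K Z.
  apply: (closed_cvg (F := iterated_filter F) K
    (u_ := fun p => tcompress (U p) (P p.2).1) Kclosed); last first.
    by apply/sot_cvgP => j h; exact: UZ.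
  by apply: nearW => p; apply: Kfree.1 => //; exact: (PE p.2).1.
exists Z => //; exists S; apply: satupleP => j h; apply: hdot_eqr => w.
apply: (@ccvg_unique R _ (iterated_filter F) _ (fun p => hdot w (p.2 j h))).
  apply: ccvg_hdot; first exact: cvg_cst.
  have /sot_cvgP/(_ j h)/hcvgP Yj := FY.
  by apply/hcvgP => d /Yj; exact: iterated_filter_snd.
have ZM : \forall p \near iterated_filter F, forall j h,
    hnorm (tcompress (U p) (P p.2).1 j h) <= M * hnorm h.
  by apply: nearW => p i k; apply: hnorm_compress_le => x; apply: KM; exact: (PE p.2).1.
rewrite tcompressE -adjP.
(* Inserting [U U^*] turns [<w, V^* Gamma(X) V h>] into [<U^* V w, Gamma(U^* X U) U^* V h>], where
   both entries converge. *)
have GU : poly_fun (Gamma j) (tcompress (U p) (P p.2).1) (adj (U p) ((P p.2).2 h))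
    @[p --> iterated_filter F] --> poly_fun (Gamma j) Z (S h).
  exact: (poly_fun_cvg ZM UZ).
apply: ccvg_near_ext (ccvg_hdot (US w) GU) _.
have : \forall p \near iterated_filter F, C p.2 by apply: iterated_filter_snd; exact: GF.
apply: filterS => p /(PE p.2).2 pE.
rewrite poly_fun_compress// -adjP !uU adjP.
by rewrite [RHS](congr1 (fun A : satuple H r => hdot w (A j h)) pE).
Qed.

Hypothesis hgr : (g <= r)%N.
Hypothesis Gamma_var : forall j : 'I_g, sym_poly (Gamma (widen_ord hgr j)) = fvar R j.

(** If [Gamma(Y) = V^* Gamma(X) V], the first [g] coordinates read [Y = V^* X V], so [(X, V)] is a
    Gamma-pair and [Y] is in the hull. Conversely, the preimage is Gamma-convex, since for a
    Gamma-pair compression commutes with Gamma. *)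
Lemma Gamma_convex_hullE : Gamma_convex_hull Gamma K =
  [set Y | operator_convex_hull (Geval Gamma @` K) (Geval Gamma Y)].
Proof.
have [[CU CW] CV] : operator_convex (operator_convex_hull (Geval Gamma @` K)).
  exact: operator_convex_hull_convex.
apply/seteqP; split=> [Y|Y]; last first.
  rewrite /= hull_Geval_imageE => -[X KX [V YE]] D [[_ DV] KD].
  have YX : Y = tcompress V X.
    apply: satupleP => j h; have := congr1 (fun A : satuple H r => A (widen_ord hgr j) h) YE.
    by rewrite tcompressE /= !Gamma_var !poly_fun_var.
  by rewrite YX; apply: DV; [exact: KD|rewrite /Gamma_pair -YE YX].
apply; split; last first.
  by move=> X KX /= D [_]; apply; exists X.
split; last by move=> X V /= CX <-; exact: CV.
split=> [X U /= CX uU|n X W Z n0 CX uW WXZ]; first by rewrite Geval_compress//; exact: CU.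
exact: CW n0 CX uW (Geval_direct_sum Gamma WXZ).
Qed.

Lemma closed_Gamma_convex_hull : closed (Gamma_convex_hull Gamma K).
Proof.
have [M M0 KM] := tbounded_hnorm_le Kbounded.
rewrite Gamma_convex_hullE; apply: closed_filterP => F Y FF FC FY.
apply: (closed_cvg _ (u_ := Geval Gamma) closed_hull_Geval_image FC).
apply/sot_cvgP => j h.
apply: (@poly_fun_cvg R H _ F _ g (fun t => t) Y M _ _ (Gamma j) (fun=> h) h); last exact: cvg_cst.
  (* The first [g] coordinates show that points of the hull are compressions of points of [K], hence
     bounded by [M]; on such sets Gamma is strongly continuous. *)
  apply: filterS FC => X /=; rewrite hull_Geval_imageE => -[X' KX' [V XE]] i k.
  have -> : X i = compress V (X' i).
    apply: saopP => x; have := congr1 (fun A : satuple H r => A (widen_ord hgr i) x) XE.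
    by rewrite tcompressE /= !Gamma_var !poly_fun_var.
  by apply: hnorm_compress_le => x; exact: KM.
by move=> i k; move/sot_cvgP: FY; apply.
Qed.

End Closedness.

Theorem theorem3p3 (R : realType) (H : hilbertType R)
    (Hinf : infinite_dimensional H) (Hsep : separable_space H)
    (g r : nat) (hgr : (g <= r)%N) (Gamma : 'I_r -> sym_fpoly R g)
    (Gamma_var : forall j : 'I_g,
      sym_poly (Gamma (widen_ord hgr j)) = fvar R j)
    (K : set (satuple H g)) (Kfree : free_set K)
    (Kbounded : tbounded K) (Kclosed : closed K) :
  closed (operator_convex_hull (Geval Gamma @` K)) /\
  closed (Gamma_convex_hull Gamma K).
Proof.
split; first exact: closed_hull_Geval_image.
exact: closed_Gamma_convex_hull.
Qed.
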